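(* Assume that $f:\mathbb{R}^d\to\mathbb{R}$ is differentiable with Lipschitz continuous gradient with constant $L>0$, and let $\sigma>0$. Then the following statements hold. (i) For any $x\in\mathbb{R}^d$ and $h\in\mathbb{R}^d$, $$\langle h,\nabla^2f_\sigma(x)h\rangle=\big\langle h,\ \mathbb{E}_{u\sim\mathcal{N}(0,I)}\big[\nabla^2f(x+\sigma u)\cdot\mathbb{I}_{\mathfrak{D}_\sigma}(u)\big]h\big\rangle,$$ where $\mathfrak{D}_\sigma:=\{u\in\mathbb{R}^d:\ \nabla f\text{ is differentiable at }x+\sigma u\}$ and $\mathbb{I}_{\mathfrak{D}_\sigma}$ is the characteristic (0-1 indicator) function of $\mathfrak{D}_\sigma$. (ii) For any $\epsilon>0$ and $\delta>0$, it holds that $$-2\epsilon+\lambda_{\min}[\nabla^2f_\sigma(x)]\le\inf_{\|h\|=1}\mathfrak{s}\big(h,\partial^2_{G,\delta}f(x)h\big)\qquad\forall x\in\mathbb{R}^d\ \text{ and }\ \forall\sigma\in(0,\bar\sigma],$$ where $$\bar\sigma:=\min\{1,\delta/H\},\qquad H:=\sqrt{-d\cdot W_{-1}\big(-\eta_1^{2/d}/(2\pi e)\big)},\qquad \eta_1:=\min\{\epsilon/(4L),\,(2\pi)^{d/2}-0.5\},$$ and $W_{-1}$ is the negative real branch of the Lambert $W$ function.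
   Context: For $\sigma>0$, the Gaussian smoothing of $f$ is $f_\sigma(x):=\mathbb{E}_{u\sim\mathcal{N}(0,I)}[f(x+\sigma u)]$, where $\mathcal{N}(0,I)$ is the $d$-dimensional standard Gaussian distribution; when $f$ has Lipschitz gradient, $f_\sigma$ is well defined and twice continuously differentiable. $\lambda_{\min}$ denotes the minimum eigenvalue of a symmetric matrix, and $\|\cdot\|$ is the Euclidean norm. The integrand $\nabla^2f(x+\sigma u)\cdot\mathbb{I}_{\mathfrak{D}_\sigma}(u)$ is understood to be $0$ for $u\notin\mathfrak{D}_\sigma$. For $f$ continuously differentiable with locally Lipschitz gradient, $\partial_H^2f(x):=\mathrm{conv}\{M:\ \exists\, x^k\to x\text{ with } f\text{ twice differentiable at }x^k\text{ and }\nabla^2f(x^k)\to M\}$. For $\delta>0$, the Goldstein second-order $\delta$-subdifferential of $f$ at $x$ is $\partial^2_{G,\delta}f(x):=\mathrm{conv}\big(\bigcup_{y\in\mathbb{B}(x,\delta)}\partial_H^2f(y)\big)$, where $\mathbb{B}(x,\delta)$ is the closed ball with center $x$ and radius $\delta$. For $h\in\mathbb{R}^d$, $\partial^2_{G,\delta}f(x)h:=\{Mh:\ M\in\partial^2_{G,\delta}f(x)\}$, and $\mathfrak{s}(h,\Omega):=\sup_{z\in\Omega}\langle h,z\rangle$ is the support function of the set $\Omega$. $W_{-1}$ is the inverse of $w\mapsto we^w$ restricted to $(-\infty,-1]$, defined on $[-1/e,0)$. Since $\eta_1\le(2\pi)^{d/2}-0.5$, the argument $-\eta_1^{2/d}/(2\pi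 e)$ lies in $(-1/e,0)$, so $H\in(\sqrt d,\infty)$. *)

(* Defs.v *)
From HB Require Import structures.
From mathcomp Require Import all_boot all_order all_algebra.
From mathcomp Require Import all_classical all_reals all_analysis.

Set Implicit Arguments.
Unset Strict Implicit.
Unset Printing Implicit Defensive.
Import Order.TTheory GRing.Theory Num.Theory.
Import numFieldNormedType.Exports.
Local Open Scope classical_set_scope.
Local Open Scope ring_scope.

Section euclidean.
Context {R : realType} {d : nat}.
Implicit Types (u v x : 'cV[R]_d) (f : 'cV[R]_d -> R) (A : 'M[R]_d).

Definition dot u v : R := (u^T *m v) 0 0.

(* The library norm on matrices is the sup norm, hence the separate name; it
   induces the same topology, so [differentiable] and [-->] are unaffected. *)
Definition enorm u : R := Num.sqrt (dot u u).

Definition eball x (r : R) : set 'cV[R]_d := [set y | enorm (y - x) <= r].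

Definition gradient f x : 'cV[R]_d := \col_i 'd f x (delta_mx i 0).

Definition hessian f x : 'M[R]_d :=
  \matrix_(i, j) 'd (gradient f) x (delta_mx j 0) i 0.

Definition twice_differentiable f x : Prop :=
  (\forall y \near x, differentiable f y) /\ differentiable (gradient f) x.

(* Meant for symmetric [A] and [0 < d]: the set is then finite and nonempty,
   so that the infimum is a minimum. *)
Definition lambda_min A : R := inf [set a | eigenvalue A a].

End euclidean.

Definition conv_hull {R : numDomainType} {V : lmodType R} (A : set V) : set V :=
  smallest (@convex_set R V) A.

Section generalized_hessian.
Context {R : realType} {d : nat}.
Implicit Types (x h : 'cV[R]_d) (f : 'cV[R]_d -> R).

Definition hess_subdiff f x : set 'M[R]_d :=
  conv_hull [set M : 'M[R]_d | exists xk : nat -> 'cV[R]_d,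
    [/\ xk @ \oo --> x,
        forall k, twice_differentiable f (xk k)
      & hessian f (xk k) @[k --> \oo] --> M]].

Definition goldstein_hess (delta : R) f x : set 'M[R]_d :=
  conv_hull (\bigcup_(y in eball x delta) hess_subdiff f y).

Definition goldstein_hess_at (delta : R) f x h : set 'cV[R]_d :=
  [set M *m h | M in goldstein_hess delta f x].

Definition support_fun h (Omega : set 'cV[R]_d) : \bar R :=
  ereal_sup [set (dot h z)%:E | z in Omega].

End generalized_hessian.

Section gaussian.
Context {R : realType}.

Local Notation mR := (measurableTypeR R).

Definition cons_pair n (p : mR * n.-tuple mR) : n.+1.-tuple mR :=
  [tuple of p.1 :: p.2].

Lemma measurable_cons_pair n : measurable_fun setT (@cons_pair n).
Proof. exact: measurable_cons. Qed.

HB.instance Definition _ n :=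
  isMeasurableFun.Build _ _ _ _ (@cons_pair n) (@measurable_cons_pair n).

(* N(0, I) as the n-fold product of N(0, 1), carried by tuples because the
   library equips these, and not matrices, with the product sigma-algebra. *)
Fixpoint std_gaussian (n : nat) : probability (n.-tuple mR) R :=
  match n with
  | 0 => dirac ([tuple] : 0.-tuple mR)
  | m.+1 => distribution (normal_prob (0 : R) 1 \x std_gaussian m)%E (@cons_pair m)
  end.

Context {d : nat}.

Definition vec_of_tuple (t : d.-tuple mR) : 'cV[R]_d := \col_i tnth t i.

Definition gauss_mean (g : 'cV[R]_d -> R) : R :=
  \int[std_gaussian d]_t g (vec_of_tuple t).

Definition gauss_mean_mx m n (G : 'cV[R]_d -> 'M[R]_(m, n)) : 'M[R]_(m, n) :=
  \matrix_(i, j) gauss_mean (fun u => G u i j).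

Definition gauss_smooth (sigma : R) (f : 'cV[R]_d -> R) (x : 'cV[R]_d) : R :=
  gauss_mean (fun u => f (x + sigma *: u)).

End gaussian.

Section radius.
Context {R : realType}.

Definition lambertWm1 : R -> R :=
  pinv (`]-oo, -1] : set R) (fun w : R => w * expR w).

Variables (d : nat) (L eps delta : R).

Definition eta1 : R :=
  Num.min (eps / (4 * L)) ((2 * pi) `^ (d%:R / 2) - 2^-1).

Definition radiusH : R :=
  Num.sqrt (- (d%:R * lambertWm1 (- (eta1 `^ (2 / d%:R) / (2 * pi * expR 1))))).

Definition sigma_bar : R := Num.min 1 (delta / radiusH).

End radius.

(* Main.v *)
(* Since [f] is C^{1,1}, Rademacher's theorem makes its gradient differentiable
   at [x + sigma u] for almost every Gaussian [u]; dominated convergence then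
   allows one to differentiate the expected gradient under the expectation,
   which is (i).  For (ii), symmetry of the Hessian reduces the claim to
   [<h, Hess f_sigma(x) h>] for one unit vector [h]: up to a null set, the
   integrand of (i) is at most the support function when [sigma |u| <= delta],
   and at most [L] otherwise.  Chernoff's bound
   [P(|u|^2 >= d T) <= (T e^(1-T))^(d/2)] at [T = -W_{-1}(...)] equals
   [eta_1 / (2 pi)^(d/2)] by the defining equation of [W_{-1}].

   Rademacher's theorem for a Lipschitz [g] is proved by adding one coordinate
   at a time.  In dimension one, [g x + K x] is the distribution function of a
   Stieltjes measure dominated by Lebesgue measure, so Radon-Nikodym and
   Lebesgue's differentiation theorem apply.  By Fubini every Lipschitz
   function has all partial derivatives almost everywhere.  Let [A] be the set
   of points at which a fixed rational vector approximates [g] along the first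
   [k] coordinates, with a fixed error at a fixed scale.  The distance to [A]
   is Lipschitz; where it has a [k]-th partial derivative at a point [x] of
   [A], that derivative is [0], because [x] is a minimum.  Hence [A] comes
   within [o(t)] of [x + t e_k], which carries the approximation at [x] over
   to the first [k+1] coordinates. *)

From HB Require Import structures.
Require Import Defs.
From mathcomp Require Import all_boot all_order all_algebra.
From mathcomp Require Import all_classical all_reals all_analysis.
From mathcomp Require Import measurable_realfun ring lra.
Import Order.TTheory GRing.Theory Num.Theory.
Import numFieldNormedType.Exports.
Set Implicit Arguments.
Unset Strict Implicit.
Unset Printing Implicit Defensive.
Local Open Scope classical_set_scope.
Local Open Scope ring_scope.

(** * Lipschitz functions of one real variable *)

Section lipschitz_line.
Context {R : realType}.
Local Notation mu := (@lebesgue_measure R).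

Lemma stieltjes_oc (F : cumulative R R) (a b : R) : a <= b ->
  lebesgue_stieltjes_measure F `]a, b] = (F b - F a)%:E.
Proof.
move=> ab; rewrite /lebesgue_stieltjes_measure /measure_extension.
by rewrite measurable_mu_extE/= ?wlength_itv_bnd//; exact: is_ocitv.
Qed.

(** On half-open intervals the two Stieltjes measures add up to [k] times the length. By uniqueness
    of Lebesgue measure their sum is [k] times that measure, and each summand lies below it. *)
Lemma stieltjes_le_lebesgue (F G : cumulative R R) (k : R) : 0 < k ->
  (forall x, F x + G x = k * x) ->
  forall A : set (measurableTypeR R), measurable A ->
  (lebesgue_stieltjes_measure F A <= k%:E * mu A)%E.
Proof.
move=> k0 FG A mA.
have k0' : 0 <= k^-1 by rewrite invr_ge0 ltW.
pose nu := mscale (NngNum k0') (measure_add (lebesgue_stieltjes_measure F)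
  (lebesgue_stieltjes_measure G)).
have nuE B : nu B = ((k^-1)%:E * (lebesgue_stieltjes_measure F B +
    lebesgue_stieltjes_measure G B))%E.
  by rewrite -measure_addE.
have -> : mu A = nu A.
  apply: lebesgue_measure_unique => // X [[a b] _ /= <-]; apply: (etrans _ (esym (nuE _))).
  have [ab|ba] := leP a b; last first.
    by rewrite set_itv_ge ?measure0 ?adde0 ?mule0 ?measure0// bnd_simp -leNgt ltW.
  rewrite [X in (X + _)%E](stieltjes_oc F ab) [X in (_ + X)%E](stieltjes_oc G ab).
  rewrite [LHS](stieltjes_oc idfun ab).
  rewrite -EFinD -EFinM /=; congr EFin.
  have -> : F b - F a + (G b - G a) = k * (b - a).
    by rewrite mulrBr -!FG; ring.
  by rewrite mulKf ?gt_eqF.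
rewrite nuE muleA -EFinM mulfV ?gt_eqF// mul1e.
by rewrite leeDl.
Qed.

Lemma lipschitz_ae_derivable (g : R -> R) (K : R) :
  (forall x y, `|g x - g y| <= K * `|x - y|) ->
  {ae mu, forall x, derivable g x 1}.
Proof.
wlog K0 : K / 0 < K => [H|].
  move=> gK; apply: (H (`|K| + 1)); first by rewrite ltr_pwDr.
  move=> x y; rewrite (le_trans (gK x y))// ler_wpM2r//.
  by rewrite (le_trans (ler_norm K))// lerDl.
move=> gK.
have cg : continuous g.
  move=> x; apply/(@cvgrPdist_le _ R^o) => e e0; apply/nbhs_ballP.
  exists (K^-1 * e) => /= [|y]; first by rewrite mulr_gt0// invr_gt0.
  rewrite /ball/= => /ltW xy.
  by rewrite (le_trans (gK _ _))// -ler_pdivlMl.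
(* The values [s = 1] and [s = -1] give two nondecreasing functions with sum [2 K x]; the second one
   bounds the Stieltjes measure of the first. *)
have cs (s : R) : continuous (fun x : R => K * x + s * g x).
  move=> x; apply: (@cvgD _ R^o); apply: cvgM => //; try exact: (@cvg_cst R^o).
  exact: cg.
have nd (s : R) : `|s| = 1 -> nondecreasing (fun x : R => K * x + s * g x).
  move=> s1 x y xy; rewrite -subr_ge0.
  have -> : K * y + s * g y - (K * x + s * g x) = K * (y - x) - s * (g x - g y).
    by ring.
  rewrite subr_ge0 (le_trans (ler_norm _))// normrM s1 mul1r.
  by rewrite (le_trans (gK _ _))// distrC ger0_norm ?subr_ge0.
have n1 : `|1 : R| = 1 by rewrite normr1.
have nN1 : `|-1 : R| = 1 by rewrite normrN normr1.
pose F : cumulative R R := HB.pack (fun x : R => K * x + 1 * g x)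
  (isCumulative.Build R _ R _ (nd _ n1) (right_continuousW (cs 1))).
pose G : cumulative R R := HB.pack (fun x : R => K * x + -1 * g x)
  (isCumulative.Build R _ R _ (nd _ nN1) (right_continuousW (cs (-1)))).
have K20 : 0 < 2 * K by rewrite mulr_gt0.
have Fle := @stieltjes_le_lebesgue F G (2 * K) K20.
have {}Fle A : measurable A ->
    (lebesgue_stieltjes_measure F A <= (2 * K)%:E * mu A)%E.
  by apply: Fle => x; rewrite /F /G /=; ring.
(* The Stieltjes measure may have infinite mass; its restriction to a bounded interval is finite, as
   a Radon-Nikodym density that is integrable requires. *)
have main (N : nat) : {ae mu, forall x : R, `|x| < N%:R -> derivable g x 1}.
  pose D : set (measurableTypeR R) := `](- N%:R), N%:R]%classic.
  have mD : measurable D by exact: measurable_itv.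
  have Doo : (lebesgue_stieltjes_measure F D < +oo)%E.
    by rewrite /D stieltjes_oc ?ltry// ge0_cp.
  pose nu := mfrestr mD Doo.
  have nu_mu : nu `<< mu.
    apply/null_content_dominatesP => A mA muA0.
    rewrite /nu /= /mfrestr /mrestr; apply/eqP; rewrite -measure_le0.
    have mAD : measurable (A `&` D) by exact: measurableI.
    rewrite (le_trans (Fle _ mAD))//.
    rewrite (_ : mu (A `&` D) = 0%E) ?mule0//.
    by apply: (subset_measure0 mAD mA) => //; exact: subIsetl.
  have [f [f0 ffin intf fE]] := radon_nikodym_sigma_finite nu_mu.
  pose f' : R -> R := fine \o f.
  have f'E : EFin \o f' = f by apply/funext => x; rewrite /f' /= fineK.
  have intf' : mu.-integrable setT (EFin \o f') by rewrite f'E.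
  have := @FTC1 R f' (BRight (- N%:R)) _ _.
  move=> /(_ _ _)/=.
  have H1 : forall y, mu.-integrable [set` Interval (BRight (- N%:R)) (BRight y)]
     (EFin \o f') by move=> y; exact: integrableS intf'.
  have H2 : locally_integrable [set: R] f'.
    by apply: open_integrable_locally => //; exact: openT.
  move=> /(_ H1 H2).
  apply: filterS; first exact: (ae_filter_ringOfSetsType mu).
  move=> x dF xN.
  have /andP[Nx xN'] : - N%:R < x < N%:R by rewrite -ltr_norml.
  have /dF {dF} [dF _] : ((- N%:R : R)%:E < x%:E)%E by rewrite lte_fin.
  (* Near [x], [g] is the indefinite integral of the density plus an affine function. *)
  have gE : {near x, (fun x => \int[mu]_(t in `](- N%:R), x]) f' t
      + (F (- N%:R) - K * x)) =1 g}.
    near=> y.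
    have /andP[Ny yN] : - N%:R < y < N%:R.
      near: y; apply: (near_in_itvoo); by rewrite in_itv/= Nx.
    have -> : \int[mu]_(t in `](- N%:R), y]) f' t = F y - F (- N%:R).
      rewrite /Rintegral; apply: EFin_inj; rewrite fineK; last first.
        apply: integrable_fin_num => //; exact: H1.
      have /= := @fE `](- N%:R), y]%classic (measurable_itv _).
      rewrite -f'E => <-; rewrite /nu/= /mfrestr /mrestr setIidl.
        by rewrite stieltjes_oc// ltW.
      by apply: subset_itvl; rewrite bnd_simp ltW.
    rewrite /F /=; ring.
  apply: near_eq_derivable gE _.
  apply: derivableD => //.
have : {ae mu, forall x : R, forall N : nat, `|x| < N%:R -> derivable g x 1}.
  exact/ae_foralln.
apply: filterS; first exact: (ae_filter_ringOfSetsType mu).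
move=> x /(_ (Num.bound `|x|)); apply.
exact: archi_boundP.
Unshelve. all: by end_near. Qed.

End lipschitz_line.

(** * From partial derivatives to a gradient *)

Section sup_norm.
Context {R : realType} {d : nat}.
Implicit Types (u v w x p : 'cV[R]_d).
Local Notation e_ i := (delta_mx i 0 : 'cV[R]_d).

Lemma dotE u v : dot u v = \sum_i u i 0 * v i 0.
Proof. by rewrite /dot mxE; apply: eq_bigr => i _; rewrite mxE. Qed.

Lemma dotC u v : dot u v = dot v u.
Proof. by rewrite !dotE; apply: eq_bigr => i _; rewrite mulrC. Qed.

Lemma dotDr u v w : dot u (v + w) = dot u v + dot u w.
Proof. by rewrite /dot mulmxDr mxE. Qed.

Lemma dotZr u (a : R) v : dot u (a *: v) = a * dot u v.
Proof. by rewrite /dot -scalemxAr mxE. Qed.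

Lemma dotDl u v w : dot (v + w) u = dot v u + dot w u.
Proof. by rewrite dotC dotDr !(dotC u). Qed.

Lemma dotZl u (a : R) v : dot (a *: v) u = a * dot v u.
Proof. by rewrite dotC dotZr dotC. Qed.

Lemma dotBl u v w : dot (v - w) u = dot v u - dot w u.
Proof. by rewrite dotDl -scaleN1r dotZl mulN1r. Qed.

Lemma dotBr u v w : dot u (v - w) = dot u v - dot u w.
Proof. by rewrite !(dotC u) dotBl. Qed.

Lemma dot_delta u i : dot u (e_ i) = u i 0.
Proof.
rewrite dotE (bigD1 i)//= mxE !eqxx mulr1 big1 ?addr0// => j ji.
by rewrite mxE (negbTE ji) mulr0.
Qed.

Lemma mx_norm_coord m n (M : 'M[R]_(m, n)) i j : `|M i j| <= `|M|.
Proof.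
rewrite [leRHS]/Num.norm/= mx_normrE.
exact: (le_bigmax _ (fun ij : 'I_m * 'I_n => `|M ij.1 ij.2|) (i, j)).
Qed.

Lemma mx_norm_le m n (M : 'M[R]_(m, n)) (c : R) : 0 <= c ->
  (forall i j, `|M i j| <= c) -> `|M| <= c.
Proof.
move=> c0 Mc; rewrite [leLHS]/Num.norm/= mx_normrE.
by apply: bigmax_le => // -[i j] _; exact: Mc.
Qed.

Lemma cV_norm_le v (c : R) : 0 <= c -> (forall i, `|v i 0| <= c) -> `|v| <= c.
Proof. by move=> c0 vc; apply: mx_norm_le => // i j; rewrite ord1. Qed.

Lemma norm_delta i : `|e_ i| = 1.
Proof.
apply/eqP; rewrite eq_le; apply/andP; split.
  by apply: cV_norm_le => // j; rewrite mxE; case: andb; rewrite ?normr1 ?normr0.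
by have := mx_norm_coord (e_ i) i 0; rewrite mxE !eqxx normr1.
Qed.

Lemma dot_le_sum u v : `|dot u v| <= (\sum_i `|u i 0|) * `|v|.
Proof.
rewrite dotE (le_trans (ler_norm_sum _ _ _))// mulr_suml; apply: ler_sum => i _.
by rewrite normrM ler_wpM2l// mx_norm_coord.
Qed.

Lemma dot_le_norm u v : `|dot u v| <= d%:R * `|u| * `|v|.
Proof.
rewrite (le_trans (dot_le_sum u v))// ler_wpM2r// mulr_natl.
rewrite (le_trans (ler_sum _ (G := fun=> `|u|) _))// => [i _|].
  exact: mx_norm_coord.
by rewrite sumr_const card_ord.
Qed.

End sup_norm.

(** * Distance to a set *)

Section distance.
Context {R : realType} {V : normedModType R}.
Implicit Types (A : set V) (x y : V).

(** For empty [A] this is the constant [0], by the convention [inf set0 = 0]. *)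
Definition dist_to A x : R := inf [set `|x - a| | a in A].

Lemma dist_to_ge0 A x : 0 <= dist_to A x.
Proof.
rewrite /dist_to; have [->|A0] := eqVneq [set `|x - a| | a in A] set0.
  by rewrite inf0.
apply: lb_le_inf; first exact/set0P.
by move=> _ [a _ <-]; exact: normr_ge0.
Qed.

Lemma has_inf_dist A x : A !=set0 -> has_inf [set `|x - a| | a in A].
Proof.
move=> [a Aa]; split; first by exists `|x - a|; exists a.
by exists 0 => _ [b _ <-].
Qed.

Lemma dist_to_le A x a : A a -> dist_to A x <= `|x - a|.
Proof.
move=> Aa; apply: ge_inf; last by exists a.
by exists 0 => _ [b _ <-].
Qed.

Lemma dist_to_mem A x : A x -> dist_to A x = 0.
Proof.
move=> Ax; apply/eqP; rewrite eq_le dist_to_ge0 andbT.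
by rewrite (le_trans (dist_to_le x Ax))// subrr normr0.
Qed.

Lemma dist_to_lt A x (e : R) : A !=set0 -> dist_to A x < e ->
  exists2 a, A a & `|x - a| < e.
Proof.
move=> A0; rewrite -subr_gt0 => e0.
have [_ [a Aa <-] ae] := inf_adherent e0 (has_inf_dist x A0).
by exists a => //; rewrite (lt_le_trans ae)// addrC subrK.
Qed.

Lemma dist_to_lipschitz A x y : `|dist_to A x - dist_to A y| <= 1 * `|x - y|.
Proof.
rewrite mul1r.
wlog suff : x y / dist_to A x - dist_to A y <= `|x - y|.
  move=> H; rewrite ler_norml H andbT lerNl opprB distrC; exact: H.
have [A0|/set0P A0] := eqVneq A set0.
  by rewrite /dist_to A0 !image_set0 inf0 subrr.
rewrite lerBlDl; apply/ler_addgt0Pr => e e0.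
have [a Aa ya] : exists2 a, A a & `|y - a| < dist_to A y + e.
  by apply: dist_to_lt => //; rewrite ltrDl.
rewrite (le_trans (dist_to_le x Aa))//.
rewrite -(subrKA y) (le_trans (ler_normD _ _))//.
by rewrite [leLHS]addrC addrAC lerD2r ltW.
Qed.

End distance.

Lemma exists_invn_le (R : realType) (e : R) : 0 < e -> exists n : nat, n.+1%:R^-1 <= e.
Proof.
move=> e0; near \oo => n; exists n; apply: ltW.
by near: n; exact: near_infty_natSinv_lt (PosNum e0).
Unshelve. all: by end_near. Qed.

(** * Extending a linear approximation by one coordinate *)

Section rademacher_deterministic.
Context {R : realType} {d : nat}.
Implicit Types (g : 'cV[R]_d -> R) (x p w : 'cV[R]_d).
Local Notation e_ i := (delta_mx i 0 : 'cV[R]_d).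

(** Fréchet differentiability with explicit quantifiers, the gradient being a parameter.
    [has_gradient_diff] and [differentiable_has_gradient] translate to and from [differentiable]. *)
Definition has_gradient g x p := forall e : R, 0 < e -> exists2 r : R, 0 < r &
  forall v, `|v| < r -> `|g (x + v) - g x - dot p v| <= e * `|v|.

Definition has_partial (i : 'I_d) g x (l : R) :=
  forall e : R, 0 < e -> exists2 r : R, 0 < r &
  forall t : R, `|t| < r -> `|g (x + t *: e_ i) - g x - t * l| <= e * `|t|.

(* [x] belongs to it when [p] approximates the increments of [g] at [x] along
   the span of the coordinates in [S], up to the error [e], at scale [r] *)
Definition linear_approx (S : pred 'I_d) g p (e r : R) : set 'cV[R]_d :=
  [set x | forall w, (forall i, ~~ S i -> w i 0 = 0) -> `|w| < r ->
    `|g (x + w) - g x - dot p w| <= e * `|w|].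

Lemma rat_approx (p : 'cV[R]_d) (e : R) : 0 < e ->
  exists q : 'cV[rat]_d, `|p - map_mx ratr q| <= e.
Proof.
move=> e0.
have H i : exists q : rat, `|p i 0 - ratr q| <= e.
  have /rat_in_itvoo [q] : p i 0 < p i 0 + e by rewrite ltrDl.
  rewrite in_itv/= => /andP[pq qp]; exists q.
  by rewrite distrC ger0_norm ?subr_ge0 ?lerBlDl ltW.
pose q i := sval (cid (H i)).
exists (\col_i q i); apply: cV_norm_le; first exact: ltW.
by move=> i; rewrite !mxE /q; case: cid.
Qed.

(** A step [t] against the sign of [l] lowers the linear part by [|t| |l|]. As [g] stays
    nonnegative, the error term must make up for this, so [|l| <= e] for every [e]. *)
Lemma has_partial_min i g x l : (forall y, 0 <= g y) -> g x = 0 ->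
  has_partial i g x l -> l = 0.
Proof.
move=> g0 gx gl; apply/eqP; rewrite -normr_le0; apply/ler_addgt0Pr => e e0.
rewrite add0r; have [r r0 H] := gl e e0.
pose t := - Num.sg l * (r / 2).
have [->|l0] := eqVneq l 0; first by rewrite normr0 ltW.
have tE : `|t| = r / 2.
  rewrite /t normrM normrN [`|r / 2|]ger0_norm ?divr_ge0 ?ltW//.
  by rewrite normr_sg l0 mul1r.
have := H t; rewrite tE gx subr0 ltr_pdivrMr// ltr_pMr// ltr1n => /(_ isT).
have -> : t * l = - ((r / 2) * `|l|).
  by rewrite /t normrEsg; ring.
rewrite opprK ger0_norm ?addr_ge0 ?mulr_ge0 ?divr_ge0 ?(ltW r0)// => {}H.
have r20 : 0 < r / 2 by rewrite divr_gt0.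
have : r / 2 * `|l| <= e * (r / 2) by rewrite (le_trans _ H)// lerDr.
by rewrite mulrC ler_pM2r.
Qed.

(** Induction on the number of coordinates. The last hypothesis is a countable family of conditions,
    so that it can hold for almost every [x] at once; it is used for the set [A] that records the
    approximation at [x] along the coordinates before [i]. *)
Lemma has_gradient_of_partials g (K : R) x p :
  (forall y z, `|g y - g z| <= K * `|y - z|) ->
  (forall i, has_partial i g x (p i 0)) ->
  (forall (i : 'I_d) (q : 'cV[rat]_d) (n m : nat), exists l, has_partial i
    (dist_to (linear_approx (fun j => (j < i)%N) g (map_mx ratr q)
      m.+1%:R^-1 n.+1%:R^-1)) x l) ->
  has_gradient g x p.
Proof.
wlog K0 : K / 0 < K => [H gK|gK gp gA].
  apply: (H (`|K| + 1)); first by rewrite ltr_pwDr.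
  move=> y z; rewrite (le_trans (gK y z))// ler_wpM2r//.
  by rewrite (le_trans (ler_norm K))// lerDl.
suff main k : (k <= d)%N -> forall e, 0 < e ->
    exists2 r : R, 0 < r & linear_approx (fun j => (j < k)%N) g p e r x.
  move=> e e0; have [r r0 H] := main d (leqnn d) e e0; exists r => // v vr.
  by apply: H => // i; rewrite ltn_ord.
elim: k => [_ e e0|k IH kd e e0].
  exists 1 => // w w0 _; have -> : w = 0.
    by apply/colP => i; rewrite w0// mxE.
  by rewrite addr0 subrr sub0r normrN normr0 mulr0 -(scale0r 0) dotZr mul0r normr0.
pose i := Ordinal kd.
have e40 : 0 < e / 4 by rewrite divr_gt0.
have [m me] := exists_invn_le e40.
(* The other half of the error [1/(m+1)] pays for replacing [p] by a rational vector. *)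
have m0 : 0 < m.+1%:R^-1 / 2 :> R by rewrite divr_gt0.
have [r r0 xr] := IH (ltnW kd) _ m0.
have [n nr] := exists_invn_le r0.
have n0 : 0 < n.+1%:R^-1 :> R by [].
have [q pq] : exists q : 'cV[rat]_d, forall w,
    `|dot (p - map_mx ratr q) w| <= m.+1%:R^-1 / 2 * `|w|.
  have d0 : 0 < (d%:R + 1)^-1 :> R by rewrite invr_gt0 ltr_pwDr.
  have [q pq] := rat_approx p (mulr_gt0 m0 d0).
  exists q => w; rewrite (le_trans (dot_le_norm _ _))// ler_wpM2r//.
  rewrite (le_trans (ler_wpM2l _ pq))// mulrCA ger_pMr//.
  by rewrite ler_pdivrMr ?mul1r ?lerDl// ltr_pwDr.
set A := linear_approx (fun j => (j < i)%N) g (map_mx ratr q) m.+1%:R^-1 n.+1%:R^-1.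
have Ax : A x.
  move=> w wk wn; have := xr w wk (lt_le_trans wn nr); have := pq w.
  have -> : g (x + w) - g x - dot (map_mx ratr q) w =
      dot (p - map_mx ratr q) w + (g (x + w) - g x - dot p w).
    by rewrite dotBl; ring.
  rewrite [m.+1%:R^-1 in X in _ -> _ -> X]splitr mulrDl => ? ?.
  by rewrite (le_trans (ler_normD _ _))// lerD.
have [l Al] := gA i q n m; rewrite -/A in Al.
have l0 : l = 0.
  by apply: has_partial_min Al; [exact: dist_to_ge0|exact: dist_to_mem].
(* Doubling this to [e / (8 K)] makes the bound on the distance strict, which yields an actual point
   of [A]; the Lipschitz constant then turns it into [e / 8]. *)
have eta0 : 0 < e / (16 * K) by rewrite divr_gt0 ?mulr_gt0.
have [r1 r10 H1] := Al _ eta0.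
have [r2 r20 H2] := gp i _ e40.
have near_A t : `|t| < r1 ->
    exists2 y, A y & `|x + t *: e_ i - y| <= e / (8 * K) * `|t|.
  move=> tr; have [->|t0] := eqVneq t 0.
    by exists x => //; rewrite scale0r addr0 subrr !normr0 mulr0.
  have := H1 t tr; rewrite l0 mulr0 subr0 (dist_to_mem Ax) subr0.
  rewrite ger0_norm ?dist_to_ge0// => H.
  have [y Ay yt] : exists2 y, A y & `|x + t *: e_ i - y| < e / (8 * K) * `|t|.
    apply: dist_to_lt; first by exists x.
    rewrite (le_lt_trans H)// ltr_pM2r ?normr_gt0// ltr_pM2l//.
    by rewrite ltf_pV2 ?posrE ?mulr_gt0// ltr_pM2r// ltr_nat.
  by exists y => //; exact: ltW.
exists (Num.min n.+1%:R^-1 (Num.min r1 r2)); first by rewrite !lt_min n0 r10 r20.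
move=> w wk; rewrite !lt_min => /and3P[wn wr1 wr2].
pose t := w i 0; pose w' := w - t *: e_ i.
have wE : w = t *: e_ i + w' by rewrite /w' addrC subrK.
have tw : `|t| <= `|w| by exact: mx_norm_coord.
have w'w : `|w'| <= `|w|.
  apply: cV_norm_le => // j; rewrite !mxE eqxx andbT.
  have [->|ji] := eqVneq j i; first by rewrite mulr1 subrr normr0.
  by rewrite mulr0 subr0 mx_norm_coord.
have w'k (j : 'I_d) : ~~ (j < k)%N -> w' j 0 = 0.
  rewrite -leqNgt leq_eqVlt => /orP[/eqP kj|kj].
    have -> : j = i by apply/val_inj.
    by rewrite !mxE !eqxx mulr1 subrr.
  rewrite !mxE eqxx andbT wk -?leqNgt// (_ : j == i = false) ?mulr0 ?subrr//.
  by apply/negbTE/eqP => ji; move: kj; rewrite ji ltnn.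
have [y Ay yt] := near_A t (le_lt_trans tw wr1).
have Aw := Ay w' w'k (le_lt_trans w'w wn).
have Bw := H2 t (le_lt_trans tw wr2).
have C1 : `|g (x + t *: e_ i + w') - g (y + w')| <= K * `|x + t *: e_ i - y|.
  by rewrite (le_trans (gK _ _))// opprD addrACA subrr addr0.
have C2 := gK (x + t *: e_ i) y.
have pw' := pq w'; rewrite dotBl in pw'.
have Ke : K * `|x + t *: e_ i - y| <= e / 8 * `|w|.
  rewrite (le_trans (ler_wpM2l (ltW K0) yt))// mulrA.
  have -> : K * (e / (8 * K)) = e / 8.
    by field; rewrite gt_eqF.
  by rewrite ler_wpM2l// divr_ge0 ?ltW.
rewrite [in X in g X]wE addrA.
have -> : dot p w = t * p i 0 + dot p w'.
  by rewrite {1}wE dotDr dotZr dot_delta.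
have e1 : e / 4 * `|t| <= e / 4 * `|w| by rewrite ler_wpM2l// ltW.
have e2 : m.+1%:R^-1 * `|w'| <= e / 4 * `|w|.
  by apply: ler_pM => //; rewrite invr_ge0.
have e3 : m.+1%:R^-1 / 2 * `|w'| <= e / 8 * `|w|.
  by rewrite mulrAC (le_trans (ler_wpM2r _ e2))//; lra.
(* The five errors: moving from [x + t e_i] to [y] after the increment [w'], the approximation at
   [y], moving back before the increment, the partial derivative at [x], and rounding [p]. They add
   up to [7/8] of what is allowed. *)
have sum5 (a1 a2 a3 a4 a5 b : R) : `|a1| <= e / 8 * b -> `|a2| <= e / 4 * b ->
    `|a3| <= e / 8 * b -> `|a4| <= e / 4 * b -> `|a5| <= e / 8 * b -> 0 <= e * b ->
    `|a1 + a2 - a3 + a4 - a5| <= e * b.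
  rewrite !ler_norml => /andP[? ?] /andP[? ?] /andP[? ?] /andP[? ?] /andP[? ?] ?.
  by apply/andP; split; lra.
have := sum5 _ _ _ _ _ _ (le_trans C1 Ke) (le_trans Aw e2) (le_trans C2 Ke)
  (le_trans Bw e1) (le_trans pw' e3) _.
rewrite mulr_ge0 ?(ltW e0)// => /(_ isT).
by congr (`|_| <= _); ring.
Qed.

End rademacher_deterministic.

(** * Null sets of the standard Gaussian *)

Section gaussian_null.
Context {R : realType}.
Local Notation mR := (measurableTypeR R).
Local Notation mu := (@lebesgue_measure R).

Lemma tuple_ball_measurable d (c : 'cV[R]_d) (r : R) :
  measurable ((@vec_of_tuple R d) @^-1` ball c r).
Proof.
have [r0|r0] := leP r 0.
  rewrite (_ : _ @^-1` _ = set0); first exact: measurable0.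
  rewrite -subset0 => t /=; rewrite -ball_normE/= => /lt_le_trans/(_ r0).
  by rewrite ltNge normr_ge0.
rewrite (_ : _ @^-1` _ = \bigcap_(i in [set: 'I_d])
    ((fun t : d.-tuple mR => tnth t i) @^-1` ball (c i 0) r)).
  apply: fin_bigcap_measurable; first exact: finite_finset.
  move=> i _; rewrite -[X in measurable X]setTI; apply: measurable_tnth => //.
  by apply: open_measurable; exact: ball_open.
apply/seteqP; split => [t [_ /= H] i _ | t H].
  by have := H i 0; rewrite mxE.
by split => // i j; rewrite ord1 mxE; exact: H.
Qed.

(** Links the topology of vectors to the product sigma-algebra of tuples: an open set is the union
    of the countably many balls with rational centre and radius [1/(n+1)] that it contains, and a
    ball of the sup norm is a box. *)
Lemma tuple_open_measurable d (U : set 'cV[R]_d) : open U ->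
  measurable ((@vec_of_tuple R d) @^-1` U).
Proof.
move=> oU.
pose I : countType := ('cV[rat]_d * nat)%type.
pose B (i : I) : set 'cV[R]_d := ball (map_mx ratr i.1 : 'cV[R]_d) i.2.+1%:R^-1.
pose F (i : I) : set (d.-tuple mR) :=
  if pselect (B i `<=` U) then (@vec_of_tuple R d) @^-1` B i else set0.
rewrite (_ : _ @^-1` U = \bigcup_(i in [set: I]) F i).
  apply: countable_bigcupT_measurable; first exact: countableP.
  move=> i; rewrite /F.
  by case: pselect => ?; [exact: tuple_ball_measurable|exact: measurable0].
apply/seteqP; split => [t Ut | t [i _]]; last first.
  by rewrite /F; case: pselect => //= BU Bt; exact: BU.
have /nbhs_ballP[e /= e0 eU] := open_nbhs_nbhs (conj oU Ut).
have e40 : 0 < e / 4 by rewrite divr_gt0.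
have [n ne4] := exists_invn_le e40.
have ne : n.+1%:R^-1 < e / 2 by rewrite (le_lt_trans ne4)//; lra.
have n0 : 0 < n.+2%:R^-1 :> R by [].
have [q tq] := rat_approx (vec_of_tuple t) n0.
have tqn : `|vec_of_tuple t - map_mx ratr q| < n.+1%:R^-1.
  by rewrite (le_lt_trans tq)// ltf_pV2 ?posrE// ltr_nat.
have BU : B (q, n) `<=` U.
  move=> y; rewrite /B -ball_normE/= => qy; apply: eU.
  rewrite -ball_normE/= -(subrKA (map_mx ratr q)) (le_lt_trans (ler_normD _ _))//.
  by rewrite [e]splitr ltrD// (lt_trans _ ne).
exists (q, n) => //; rewrite /F; case: pselect => [?|//].
by rewrite /= /B -ball_normE/= distrC.
Qed.

Lemma tuple_closed_measurable d (C : set 'cV[R]_d) : closed C ->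
  measurable ((@vec_of_tuple R d) @^-1` C).
Proof.
move=> cC; rewrite -[C]setCK preimage_setC; apply: measurableC.
exact: tuple_open_measurable (closed_openC cC).
Qed.

Definition set_coord n (t : n.-tuple mR) (i : 'I_n) (s : R) : n.-tuple mR :=
  [tuple if j == i then s else tnth t j | j < n].

(** Fubini together with the absolute continuity of the normal law. When the [i]-th coordinate is
    not the head, the head is fixed and the induction hypothesis applies to the section. *)
Lemma gaussian_line_null n (i : 'I_n) (A : set (n.-tuple mR)) : measurable A ->
  (forall t, mu [set s | A (set_coord t i s)] = 0%E) -> std_gaussian n A = 0%E.
Proof.
elim: n i A => [[]//|n IH] i A mA lA.
pose B : set (mR * n.-tuple mR) := @cons_pair R n @^-1` A.
have mB : measurable B.
  by rewrite -[B]setTI; exact: measurable_cons_pair.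
rewrite [LHS]/= /distribution /pushforward -/B.
have [[j ij]|i0] : (exists j, i = lift ord0 j) \/ i = ord0.
  by case: (unliftP ord0 i) => [j ->|->]; [left; exists j|right].
- rewrite /product_measure1; apply: integral0_eq => /= s _.
  apply: (IH j); first exact: measurable_xsection.
  move=> t; rewrite -[RHS](lA [tuple of s :: t]); congr (mu _).
  apply/seteqP; split => r; rewrite /= /xsection /= inE /B /= /cons_pair /= ij;
    (suff -> : [tuple of s :: set_coord t j r] =
        set_coord [tuple of s :: t] (lift ord0 j) r by []);
    apply: eq_from_tnth => k; rewrite [RHS]tnth_mktuple;
    (case: (unliftP ord0 k) => [l ->|->]; last by []);
    by rewrite !tnthS tnth_mktuple (inj_eq lift_inj).
(* The head coordinate has to be integrated first, hence the product measure in the other order. *)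
- transitivity ((normal_prob 0 1 \x^ std_gaussian n)%E B).
    apply: product_measure_unique => // X Y mX mY; exact: product_measure2E.
  rewrite /product_measure2; apply: integral0_eq => /= t _.
  have /null_content_dominatesP := normal_prob_dominates (0 : R) 1; apply.
    exact: measurable_ysection.
  rewrite -[RHS](lA [tuple of 0 :: t]); congr (mu _).
  apply/seteqP; split => r; rewrite /= /ysection /= inE /B /= /cons_pair /= i0;
    (suff -> : [tuple of r :: t] = set_coord [tuple of 0 :: t] ord0 r by []);
    apply: eq_from_tnth => k; rewrite [RHS]tnth_mktuple;
    (case: (unliftP ord0 k) => [l ->|->]; last by []);
    by rewrite !tnthS.
Qed.

End gaussian_null.

(** * Rademacher's theorem *)

Section continuity.
Context {R : realType} {V : normedModType R}.

Lemma lipschitz_continuous (g : V -> R) (K : R) :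
  (forall y z, `|g y - g z| <= K * `|y - z|) -> continuous g.
Proof.
move=> gK x; apply/(@cvgrPdist_le _ R^o) => e e0; apply/nbhs_ballP.
have K0 : 0 < `|K| + 1 by rewrite ltr_pwDr.
exists ((`|K| + 1)^-1 * e) => /= [|y]; first by rewrite mulr_gt0// invr_gt0.
rewrite -ball_normE/= => /ltW xy.
rewrite (le_trans (gK _ _))// (le_trans (ler_wpM2r _ (ler_norm K)))//.
rewrite (le_trans (ler_wpM2r (normr_ge0 _) (_ : `|K| <= `|K| + 1)))//.
  by rewrite lerDl.
by rewrite -ler_pdivlMl.
Qed.

Lemma increment_continuous (g : V -> R) (w : V) (c : R) :
  continuous g -> continuous (fun x => `|g (x + w) - g x - c|).
Proof.
move=> cg x; apply: (@cvg_norm _ R^o).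
apply: (@cvgB _ R^o); last exact: (@cvg_cst R^o).
apply: (@cvgB _ R^o); last exact: cg.
apply: (@cvg_comp _ _ _ (fun y => y + w) g); last exact: cg.
by apply: cvgD; [exact: cvg_id|exact: cvg_cst].
Qed.

End continuity.

(** * Countable description and measurability of differentiability *)

Section rational_approximations.
Context {R : realType} {d : nat}.
Implicit Types (g : 'cV[R]_d -> R) (x p w : 'cV[R]_d) (S : pred 'I_d).
Local Notation e_ i := (delta_mx i 0 : 'cV[R]_d).

Lemma linear_approx_weaken S g p q (e e' r r' : R) x :
  d%:R * `|p - q| + e <= e' -> r' <= r ->
  linear_approx S g p e r x -> linear_approx S g q e' r' x.
Proof.
move=> pq rr xp w wS wr; have := xp w wS (lt_le_trans wr rr).
have -> : g (x + w) - g x - dot q w =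
    dot (p - q) w + (g (x + w) - g x - dot p w) by rewrite dotBl; ring.
move=> H; rewrite (le_trans (ler_normD _ _))//.
apply: (@le_trans _ _ ((d%:R * `|p - q| + e) * `|w|)); last by rewrite ler_wpM2r.
by rewrite mulrDl lerD// dot_le_norm.
Qed.

(** Both approximations are tested on one increment [t e_i] shorter than both radii. This makes
    rational approximations with decreasing errors a Cauchy sequence. *)
Lemma linear_approx_unique S g p q (e e' r r' : R) x i : S i -> 0 < r -> 0 < r' ->
  linear_approx S g p e r x -> linear_approx S g q e' r' x ->
  `|p i 0 - q i 0| <= e + e'.
Proof.
move=> Si r0 r'0 xp xq.
pose t := Num.min r r' / 2.
have m0 : 0 < Num.min r r' by rewrite lt_min r0.
have t0 : 0 < t by rewrite divr_gt0.
have tm : t < Num.min r r' by rewrite ltr_pdivrMr// ltr_pMr// ltr1n.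
have tN : `|t *: e_ i| = t by rewrite normrZ norm_delta mulr1 gtr0_norm.
have tS (j : 'I_d) : ~~ S j -> (t *: e_ i) j 0 = 0.
  move=> Sj; rewrite !mxE eqxx andbT (_ : j == i = false) ?mulr0//.
  by apply/negbTE/eqP => ji; move: Sj; rewrite ji Si.
have := xp _ tS; have := xq _ tS; rewrite tN !dotZr !dot_delta.
move: tm; rewrite lt_min => /andP[tr tr'] => /(_ tr') H1 /(_ tr) H2.
rewrite -(ler_pM2l t0) -{1}(gtr0_norm t0) -normrM.
have -> : t * (p i 0 - q i 0) = (g (x + t *: e_ i) - g x - t * q i 0) -
   (g (x + t *: e_ i) - g x - t * p i 0) by ring.
rewrite (le_trans (ler_normB _ _))// (le_trans (lerD H1 H2))//.
by rewrite -mulrDl mulrC [e' + e]addrC.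
Qed.

(** Replaces the quantifier over real vectors [p] by countable ones, so that the set of points of
    differentiability becomes a countable intersection of countable unions of closed sets. *)
Lemma linear_approx_ratP S g x :
  (exists p, forall e, 0 < e -> exists2 r, 0 < r & linear_approx S g p e r x) <->
  (forall m : nat, exists nq : nat * 'cV[rat]_d,
    linear_approx S g (map_mx ratr nq.2) m.+1%:R^-1 nq.1.+1%:R^-1 x).
Proof.
split=> [[p xp] m|H].
  have m0 : 0 < m.+1%:R^-1 / 2 :> R by rewrite divr_gt0.
  have [r r0 xr] := xp _ m0.
  have [n nr] := exists_invn_le r0.
  have d0 : 0 < (d%:R + 1)^-1 :> R by rewrite invr_gt0 ltr_pwDr.
  have [q pq] := rat_approx p (mulr_gt0 m0 d0).
  exists (n, q) => /=; apply: linear_approx_weaken nr xr.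
  rewrite [leRHS]splitr lerD2r (le_trans (ler_wpM2l _ pq))// mulrCA ger_pMr//.
  by rewrite ler_pdivrMr ?mul1r ?lerDl// ltr_pwDr.
pose nq m := sval (cid (H m)).
have nqE m : linear_approx S g (map_mx ratr (nq m).2) m.+1%:R^-1 (nq m).1.+1%:R^-1 x.
  by rewrite /nq; case: cid.
pose q m : 'cV[R]_d := map_mx ratr (nq m).2.
have qC m m' i : S i -> `|q m i 0 - q m' i 0| <= m.+1%:R^-1 + m'.+1%:R^-1.
  by move=> Si; apply: (linear_approx_unique Si _ _ (nqE m) (nqE m')).
(* By [qC] the intervals of centre [q m i 0] and radius [1/(m+1)] meet pairwise, so the supremum of
   their left ends lies in all of them. Coordinates outside [S] do not affect the admissible
   increments and get the value [0]. *)
pose B i : set R := [set q m i 0 - m.+1%:R^-1 | m in [set: nat]].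
pose p : 'cV[R]_d := \col_i (if S i then sup (B i) else 0).
have pq m i : S i -> `|q m i 0 - p i 0| <= m.+1%:R^-1.
  move=> Si; rewrite [p i 0]mxE Si.
  have ubB m' : ubound (B i) (q m' i 0 + m'.+1%:R^-1).
    move=> _ [k _ <-]; have := qC k m' i Si.
    rewrite ler_norml => /andP[_].
    by rewrite lerBlDr lerBlDr -addrA addrC [X in _ <= X + _ -> _]addrC.
  rewrite ler_norml; apply/andP; split.
    rewrite lerNl opprB lerBlDl.
    by apply: ge_sup; [exists (q 0 i 0 - 0.+1%:R^-1); exists 0|exact: ubB].
  rewrite lerBlDr -lerBlDl.
  by apply: ub_le_sup; [exists (q m i 0 + m.+1%:R^-1)|exists m].
exists p => e e0.
have d0 : 0 < d%:R + 1 :> R by rewrite ltr_pwDr.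
have [m me] := exists_invn_le (divr_gt0 e0 d0).
exists (nq m).1.+1%:R^-1 => // w wS wr.
have := nqE m w wS wr; rewrite -/(q m) => Hw.
have -> : g (x + w) - g x - dot p w =
    dot (q m - p) w + (g (x + w) - g x - dot (q m) w) by rewrite dotBl; ring.
rewrite (le_trans (ler_normD _ _))//.
apply: (@le_trans _ _ (d%:R * m.+1%:R^-1 * `|w| + m.+1%:R^-1 * `|w|)).
  apply: lerD => //; rewrite dotE (le_trans (ler_norm_sum _ _ _))//.
  rewrite (le_trans (ler_sum _ (G := fun=> m.+1%:R^-1 * `|w|) _))// => [i _|].
    rewrite normrM; have [Si|Si] := boolP (S i).
      rewrite ler_pM// ?mx_norm_coord//.
      by have := pq m i Si; congr (`|_| <= _); rewrite !mxE.
    by rewrite (wS i Si) normr0 mulr0 mulr_ge0 ?invr_ge0.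
  by rewrite sumr_const card_ord -[leLHS]mulr_natl mulrA.
rewrite -mulrDl ler_wpM2r// -[X in _ + X]mul1r -mulrDl.
by rewrite mulrC -ler_pdivlMr.
Qed.

Lemma linear_approx_closed S g p e r : continuous g ->
  closed (linear_approx S g p e r).
Proof.
move=> cg.
rewrite (_ : linear_approx S g p e r = \bigcap_(w in [set w : 'cV[R]_d |
   (forall i, ~~ S i -> w i 0 = 0) /\ `|w| < r])
   (fun x => `|g (x + w) - g x - dot p w|) @^-1` [set s | s <= e * `|w|]).
  apply: closed_bigI => w _.
  have cf := @increment_continuous _ _ g w (dot p w) cg.
  by apply: closed_comp; [move=> ? _; exact: cf|exact: closed_le].
apply/seteqP; split => [x H w [/= w1 w2]|x H w w1 w2]; first exact: H.
exact: (H w).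
Qed.

Lemma linear_approx_measurable S g : continuous g ->
  measurable [set t : d.-tuple (measurableTypeR R) | exists p, forall e, 0 < e ->
    exists2 r, 0 < r & linear_approx S g p e r (vec_of_tuple t)].
Proof.
move=> cg.
rewrite (_ : [set t | _] = \bigcap_m \bigcup_(nq in [set: nat * 'cV[rat]_d])
  ((@vec_of_tuple R d) @^-1` linear_approx S g (map_mx ratr nq.2) m.+1%:R^-1
      nq.1.+1%:R^-1)).
  apply: bigcapT_measurable => m.
  apply: countable_bigcupT_measurable; first exact: countableP.
  by move=> nq; apply: tuple_closed_measurable; exact: linear_approx_closed.
apply/seteqP; split => t /=.
  by move/linear_approx_ratP => H m _; have [nq Hq] := H m; exists nq.
by move=> H; apply/linear_approx_ratP => m; have [nq _ Hq] := H m I; exists nq.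
Qed.

Lemma has_partialP i g x l : has_partial i g x l <->
  forall e, 0 < e -> exists2 r, 0 < r & linear_approx (pred1 i) g (l *: e_ i) e r x.
Proof.
split=> H e /H[r r0 Hr]; exists r => //.
  move=> w wS wr; have -> : w = w i 0 *: e_ i.
    apply/colP => j; rewrite !mxE eqxx andbT.
    by have [->|ji] := eqVneq j i; [rewrite mulr1|rewrite mulr0 wS].
  rewrite normrZ norm_delta mulr1 dotZr dotZl dot_delta mxE !eqxx mulr1.
  by apply: Hr; rewrite (le_lt_trans (mx_norm_coord _ _ _) wr).
move=> t tr; have := Hr (t *: e_ i).
rewrite normrZ norm_delta mulr1 dotZr dotZl dot_delta !mxE !eqxx mulr1; apply => //.
by move=> j /= /negbTE ji; rewrite !mxE eqxx andbT ji mulr0.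
Qed.

Lemma has_partial_exP i g x : (exists l, has_partial i g x l) <->
  exists p, forall e, 0 < e -> exists2 r, 0 < r & linear_approx (pred1 i) g p e r x.
Proof.
split=> [[l /has_partialP H]|[p H]]; first by exists (l *: e_ i).
exists (p i 0); apply/has_partialP => e /H[r r0 Hr]; exists r => // w wS wr.
suff -> : dot (p i 0 *: e_ i) w = dot p w by exact: Hr.
rewrite dotZl dotC dot_delta dotE (bigD1 i)//= big1 ?addr0// => j ji.
by rewrite wS ?mulr0.
Qed.

Lemma has_gradientP g x p : has_gradient g x p <->
  forall e, 0 < e -> exists2 r, 0 < r & linear_approx predT g p e r x.
Proof.
split=> H e /H[r r0 Hr]; exists r => //.
  by move=> w _; exact: Hr.
by move=> w; exact: Hr.
Qed.

End rational_approximations.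

(** * Differentiability almost everywhere *)

Section rademacher.
Context {R : realType} {d : nat}.
Implicit Types (g : 'cV[R]_d -> R).
Local Notation e_ i := (delta_mx i 0 : 'cV[R]_d).
Local Notation mu := (@lebesgue_measure R).

(** On each line parallel to the [i]-th axis [g] is a Lipschitz function of one variable, so the bad
    set is null there; as it is also measurable, [gaussian_line_null] applies. *)
Lemma ae_has_partial g (K : R) i : (forall y z, `|g y - g z| <= K * `|y - z|) ->
  {ae std_gaussian d, forall t, exists l, has_partial i g (vec_of_tuple t) l}.
Proof.
move=> gK; have cg := lipschitz_continuous gK.
have mG := linear_approx_measurable (pred1 i) cg.
set G := (X in measurable X) in mG.
exists (~` G); split; first exact: measurableC.
  apply: (@gaussian_line_null _ _ i); first exact: measurableC.
  move=> t.
  have vecE s : vec_of_tuple (set_coord t i s) =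
      vec_of_tuple t + (s - tnth t i) *: e_ i.
    apply/colP => j; rewrite !mxE tnth_mktuple eqxx andbT.
    by have [->|ji] := eqVneq j i; [rewrite mulr1 addrC subrK|rewrite mulr0 addr0].
  pose phi s := g (vec_of_tuple (set_coord t i s)).
  have phiK (s s' : R) : `|phi s - phi s'| <= K * `|s - s'|.
    rewrite (le_trans (gK _ _))// !vecE opprD addrACA subrr add0r -scalerBl.
    by rewrite normrZ norm_delta mulr1 opprB addrA subrK.
  have ms : measurable_fun [set: measurableTypeR R] (set_coord t i).
    apply/measurable_fun_tnthP => j.
    rewrite (_ : _ \o _ = fun s => if j == i then s else tnth t j).
      by case: (j == i).
    by apply/funext => s /=; rewrite tnth_mktuple.
  have [N [mN N0 subN]] := lipschitz_ae_derivable phiK.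
  apply/eqP; rewrite -measure_le0 -[leRHS]N0; apply: le_measure; rewrite ?inE//.
    by rewrite -[X in measurable X]setTI; apply: ms => //; exact: measurableC.
  move=> s /= sG; apply: subN => /= ds; apply: sG.
  apply/has_partial_exP; exists (phi^`()%classic s) => e e0.
  have := derivable_nbhs ds; move/eqaddoP => /(_ e e0).
  move=> /nbhs_ballP[r /= r0 Hr]; exists r => // h hr.
  have := Hr h; rewrite -ball_normE/= sub0r normrN => /(_ hr).
  rewrite /phi !vecE /= !fctE -derive1E /= opprD addrA.
  congr (`|g _ - _ - _ | <= _);  rewrite vecE -[RHS]addrA -scalerDl; congr (_ + _ *: _).
  by rewrite [h *: 1]mulr1; ring.
by move=> t /= /has_partial_exP.
Qed.

Theorem rademacher g (K : R) : (forall y z, `|g y - g z| <= K * `|y - z|) ->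
  {ae std_gaussian d, forall t, exists p, has_gradient g (vec_of_tuple t) p}.
Proof.
move=> gK.
pose A (i : 'I_d) (q : 'cV[rat]_d) (n m : nat) := linear_approx
  (fun j : 'I_d => (j < i)%N) g (map_mx ratr q) m.+1%:R^-1 n.+1%:R^-1.
(* All indices [(i, q, n, m)] are coded by one natural number, so that a single countable
   intersection suffices; codes of nothing carry the condition [True]. *)
have H1 : {ae std_gaussian d, forall t, forall k : nat,
    if (unpickle k : option ('I_d * 'cV[rat]_d * nat * nat)) is Some (i, q, n, m)
    then exists l, has_partial i (dist_to (A i q n m)) (vec_of_tuple t) l
    else True}.
  apply/ae_foralln => k; case: unpickle => [[[[i q] n] m]|].
    apply: (@ae_has_partial _ 1) => y z; exact: dist_to_lipschitz.
  by apply: aeW.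
have H2 : {ae std_gaussian d, forall t, forall k : nat,
    if insub k : option 'I_d is Some i
    then exists l, has_partial i g (vec_of_tuple t) l else True}.
  apply/ae_foralln => k; case: insub => [i|].
    exact: ae_has_partial gK.
  by apply: aeW.
move: H1 H2; apply: filterS2 => t H1 H2.
have {}H2 (i : 'I_d) : exists l, has_partial i g (vec_of_tuple t) l.
  by have := H2 i; rewrite valK.
exists (\col_i sval (cid (H2 i))); apply: has_gradient_of_partials gK _ _.
  by move=> i; rewrite mxE; case: cid.
move=> i q n m; have := H1 (pickle (i, q, n, m)).
by rewrite pickleK.
Qed.

End rademacher.

(** * Differentials and symmetry of the Hessian *)

Section differentials.
Context {R : realType}.

Lemma differentiable_approx (V W : normedModType R) (f : V -> W)
    (df : {linear V -> W}) (x : V) : continuous df ->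
  (forall e : R, 0 < e -> exists2 r : R, 0 < r &
    forall v, `|v| < r -> `|f (x + v) - f x - df v| <= e * `|v|) ->
  differentiable f x /\ 'd f x = df :> (V -> W).
Proof.
move=> cdf H.
have E : f \o shift x = cst (f x) + df +o_ 0 id.
  apply/eqaddoP => e e0; have [r r0 Hr] := H e e0.
  apply/nbhs_ballP; exists r => // v; rewrite -ball_normE/= sub0r normrN => vr.
  by rewrite !fctE/= opprD addrA addrC [v + x]addrC addrC; exact: Hr.
have dE := diff_unique cdf E.
by split=> //; apply/diff_locallyP; rewrite dE.
Qed.

Lemma differentiable_approx_inv (V W : normedModType R) (f : V -> W) (x : V) :
  differentiable f x ->
  forall e : R, 0 < e -> exists2 r : R, 0 < r &
    forall v, `|v| < r -> `|f (x + v) - f x - 'd f x v| <= e * `|v|.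
Proof.
move=> /diff_locallyP[_ /eqaddoP] H e /H /nbhs_ballP[r /= r0 Hr].
exists r => // v vr; have := Hr v; rewrite -ball_normE/= sub0r normrN => /(_ vr).
by rewrite !fctE/= opprD addrA [v + x]addrC.
Qed.

Context {d : nat}.
Implicit Types (g : 'cV[R]_d -> R) (G : 'cV[R]_d -> 'cV[R]_d) (x p v : 'cV[R]_d).
Local Notation e_ i := (delta_mx i 0 : 'cV[R]_d).

Lemma mulmx_continuous m n (A : 'M[R]_(m, n)) :
  continuous (mulmx A : 'cV[R]_n -> 'cV[R]_m).
Proof.
apply/linear_bounded_continuous/linear_boundedP.
exists (n%:R * `|A|); split => [|k /ltW nk v]; first exact: num_real.
apply: (@le_trans _ _ (n%:R * `|A| * `|v|)); last by rewrite ler_wpM2r.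
apply: cV_norm_le; first by rewrite !mulr_ge0.
move=> i; rewrite mxE (le_trans (ler_norm_sum _ _ _))//.
apply: (@le_trans _ _ (\sum_(j < n) `|A| * `|v|)).
  by apply: ler_sum => j _; rewrite normrM ler_pM// mx_norm_coord.
by rewrite sumr_const card_ord -[leLHS]mulr_natl mulrA.
Qed.

Lemma dot_is_linear p : linear (dot p).
Proof. by move=> a u v; rewrite dotDr dotZr. Qed.

Definition dot_linear p : {linear 'cV[R]_d -> R} :=
  HB.pack (dot p) (GRing.isLinear.Build _ _ _ _ _ (dot_is_linear p)).

Lemma has_gradient_diff g x p : has_gradient g x p ->
  differentiable g x /\ forall v, 'd g x v = dot p v.
Proof.
move=> gp.
have [|dg dE] := @differentiable_approx _ _ g (dot_linear p) x _ gp.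
  apply: (@lipschitz_continuous _ _ (dot p) (\sum_i `|p i 0|)) => y z.
  by rewrite -dotBr; exact: dot_le_sum.
by split=> // v; rewrite dE.
Qed.

Lemma has_gradient_gradient g x p : has_gradient g x p -> gradient g x = p.
Proof.
by move=> /has_gradient_diff[_ dE]; apply/colP => i; rewrite mxE dE dot_delta.
Qed.

Lemma diff_dotE g x v : 'd g x v = dot (gradient g x) v.
Proof.
rewrite [v in LHS]matrix_sum_delta exchange_big big_ord1 linear_sum dotE.
by apply: eq_bigr => i _; rewrite linearZ/= mxE mulrC.
Qed.

Lemma differentiable_has_gradient g x : differentiable g x ->
  has_gradient g x (gradient g x).
Proof.
move=> /differentiable_approx_inv H e /H[r r0 Hr]; exists r => // v /Hr.
by rewrite diff_dotE.
Qed.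

Lemma has_gradient_coord G x : differentiable G x -> forall i,
  has_gradient (fun y => G y i 0) x (\col_j 'd G x (e_ j) i 0).
Proof.
move=> dG i e e0; have [r r0 Hr] := differentiable_approx_inv dG e0.
exists r => // v /Hr H; apply: le_trans H.
have -> : dot (\col_j 'd G x (e_ j) i 0) v = 'd G x v i 0.
  rewrite [v in RHS]matrix_sum_delta exchange_big big_ord1 linear_sum dotE.
  rewrite summxE; apply: eq_bigr => j _; rewrite linearZ/= !mxE mulrC.
  by [].
by apply: le_trans (mx_norm_coord _ i 0); rewrite !mxE.
Qed.

Lemma differentiable_of_coord G x (A : 'M[R]_d) :
  (forall i, has_gradient (fun y => G y i 0) x (\col_j A i j)) ->
  differentiable G x /\ 'd G x = mulmx A :> ('cV[R]_d -> 'cV[R]_d).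
Proof.
move=> H.
apply: (@differentiable_approx _ _ G (mulmx A) x (@mulmx_continuous _ _ A)) => e e0.
pose r i := sval (cid2 (H i e e0)).
have r0 i : 0 < r i by rewrite /r; case: cid2.
exists (\big[Num.min/1]_i r i); first exact: lt_bigmin.
move=> v /bigmin_gtP[_ vr]; apply: cV_norm_le; first by rewrite mulr_ge0// ltW.
move=> i; have := vr i isT; rewrite /r; case: cid2 => ri ? Hri /= /Hri.
rewrite !mxE; congr (`|_ - _| <= _); rewrite dotE.
by apply: eq_bigr => j _; rewrite mxE.
Qed.

Lemma line_is_derive g x v (s : R) : differentiable g (x + s *: v) ->
  is_derive s 1 (fun s => g (x + s *: v)) (dot (gradient g (x + s *: v)) v).
Proof.
move=> dg.
have dl (s' : R) : is_diff s' (fun s : R => x + s *: v) (fun h => h *: v).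
  have := @is_diff_scalel R _ s' v.
  have := @is_diff_cst _ _ _ x s'.
  move=> H1 H2; have := is_diffD H1 H2.
  by congr (is_diff _ _ _); apply/funext => h; rewrite !fctE add0r.
have ds := @differentiable_comp _ _ _ _ (fun s : R => x + s *: v) g s _ dg.
have {}ds := ds (@ex_diff _ _ _ _ _ _ _ (dl s)).
apply: DeriveDef; first exact: diff_derivable.
rewrite deriveE// diff_comp//=.
by rewrite (@diff_val _ _ _ _ _ _ _ (dl s)) scale1r diff_dotE.
Qed.

Lemma mean_value_line g x v : (forall y, differentiable g y) ->
  exists2 c : R, 0 <= c <= 1 & g (x + v) - g x = dot (gradient g (x + c *: v)) v.
Proof.
move=> dg.
have H (s : R) : is_derive s 1 (fun s => g (x + s *: v))
    (dot (gradient g (x + s *: v)) v) by exact: line_is_derive.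
have [|c] := @MVT R (fun s => g (x + s *: v))
    (fun s => dot (gradient g (x + s *: v)) v) 0 1 ltr01.
  apply: continuous_subspaceT => s.
  by apply/differentiable_continuous/derivable1_diffP; case: (H s).
rewrite in_itv/= => /andP[/ltW c0 /ltW c1].
rewrite scale1r scale0r addr0 subr0 mulr1 => E.
by exists c => //; rewrite c0.
Qed.

Lemma hessian_has_gradient g x : differentiable (gradient g) x -> forall i,
  has_gradient (fun y => gradient g y i 0) x (\col_j hessian g x i j).
Proof.
move=> dg i; have := has_gradient_coord dg i.
by congr (has_gradient _ _ _); apply/colP => j; rewrite !mxE.
Qed.

(** For [second_difference]: [a], [b] and [b'] are the [i]-th partial derivatives of [g] at
    [x + c t e_i + t e_j], at [x + c t e_i] and at [x]; [m] is the mixed derivative, and the term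
    [n] from the common displacement [c t e_i] cancels. *)
Lemma increment_estimate (e t a b b' m n : R) : 0 < e -> 0 < t ->
  `|b - b' - n| <= e / 4 * t -> `|a - b' - (n + t * m)| <= e / 4 * (2 * t) ->
  `|t * (a - b) - t ^+ 2 * m| <= e * t ^+ 2.
Proof.
move=> e0 t0 H2 H1.
have -> : t * (a - b) - t ^+ 2 * m = t * ((a - b' - (n + t * m)) - (b - b' - n)).
  by ring.
rewrite normrM (gtr0_norm t0) [leRHS](_ : _ = t * (e * t)); last by ring.
rewrite (ler_pM2l t0) (le_trans (ler_normB _ _))// (le_trans (lerD H1 H2))//.
have et0 : 0 <= e * t by rewrite mulr_ge0 ?ltW.
by clear -et0; lra.
Qed.

(* Both mixed second partial derivatives are the limit, as [t] tends to [0], of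
   the symmetric second difference quotient of [g] with steps [t e_i, t e_j] *)
Lemma second_difference g x i j (e : R) : (forall y, differentiable g y) ->
  differentiable (gradient g) x -> 0 < e -> exists2 r : R, 0 < r &
  forall t, 0 < t < r ->
    `|g (x + t *: e_ i + t *: e_ j) - g (x + t *: e_ i) - g (x + t *: e_ j) + g x
      - t ^+ 2 * hessian g x i j| <= e * t ^+ 2.
Proof.
move=> dg ddg e0; have e40 : 0 < e / 4 by rewrite divr_gt0.
have [r r0 Hr] := hessian_has_gradient ddg i e40.
exists (r / 2); first by rewrite divr_gt0.
move=> t /andP[t0 tr].
pose h y := g (y + t *: e_ j) - g y.
have dh y : has_gradient h y (gradient g (y + t *: e_ j) - gradient g y).
  move=> e1 e10; have e120 : 0 < e1 / 2 by rewrite divr_gt0.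
  have [r1 r10 H1] := differentiable_has_gradient (dg (y + t *: e_ j)) e120.
  have [r2 r20 H2] := differentiable_has_gradient (dg y) e120.
  exists (Num.min r1 r2); first by rewrite lt_min r10.
  move=> v; rewrite lt_min => /andP[/H1 {}H1 /H2 {}H2].
  rewrite [e1]splitr mulrDl (le_trans _ (lerD H1 H2))//.
  rewrite (le_trans _ (ler_normB _ _))// dotBl /h [y + v + _]addrAC.
  have sub6 (a b c d' p q : R) : a - b - (c - d') - (p - q) = a - c - p - (b - d' - q).
    by ring.
  by rewrite sub6.
(* The mean value theorem turns the second difference into a difference of two [i]-th partial
   derivatives of [g]. Both are then expanded at [x], the one point where the gradient is known to
   be differentiable. *)
have [c /andP[c0 c1] hc] := @mean_value_line h x (t *: e_ i)
  (fun y => (has_gradient_diff (dh y)).1).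
have subE (p q : 'cV[R]_d) : (p - q) i 0 = p i 0 - q i 0 by rewrite !mxE.
rewrite (has_gradient_gradient (dh _)) dotZr dot_delta subE in hc.
have ct : `|c *: (t *: e_ i)| <= t.
  by rewrite !normrZ norm_delta mulr1 !ger0_norm ?(ltW t0)// ler_piMl// ltW.
have ctj : `|c *: (t *: e_ i) + t *: e_ j| <= 2 * t.
  rewrite (le_trans (ler_normD _ _))// mulr_natl mulr2n lerD// normrZ norm_delta.
  by rewrite mulr1 gtr0_norm.
have t2r : 2 * t < r by rewrite mulrC -ltr_pdivlMr.
have H1 := Hr _ (le_lt_trans ctj t2r).
have H2 : `|c *: (t *: e_ i)| < r.
  by rewrite (le_lt_trans ct)// (le_lt_trans _ t2r)// ler_peMl ?ltW// ltr1n.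
have {}H2 := Hr _ H2.
have {H1} := le_trans H1 (ler_wpM2l (ltW e40) ctj).
have {H2} := le_trans H2 (ler_wpM2l (ltW e40) ct).
have colE k : (\col_l hessian g x i l) k 0 = hessian g x i k by rewrite mxE.
rewrite addrA dotDr !dotZr !dot_delta !colE.
have -> : g (x + t *: e_ i + t *: e_ j) - g (x + t *: e_ i) - g (x + t *: e_ j) + g x
    = h (x + t *: e_ i) - h x by rewrite /h opprB addrA addrAC.
rewrite hc [x + c *: _ + t *: _]addrAC.
exact: increment_estimate.
Qed.

(** Second derivatives are available at [x] alone, so instead of their continuity the argument
    compares both mixed derivatives with the same second difference, which is symmetric in [i] and
    [j]. *)
Lemma hessian_sym g x : (forall y, differentiable g y) ->
  differentiable (gradient g) x -> (hessian g x)^T = hessian g x.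
Proof.
move=> dg ddg; apply/matrixP => i j; rewrite mxE.
apply/eqP; rewrite -subr_eq0 -normr_le0; apply/ler_addgt0Pr => e e0.
rewrite add0r; have e20 : 0 < e / 2 by rewrite divr_gt0.
have [r1 r10 H1] := second_difference i j dg ddg e20.
have [r2 r20 H2] := second_difference j i dg ddg e20.
pose t := Num.min r1 r2 / 2.
have m0 : 0 < Num.min r1 r2 by rewrite lt_min r10.
have t0 : 0 < t by rewrite divr_gt0.
have : t < Num.min r1 r2 by rewrite ltr_pdivrMr// ltr_pMr// ltr1n.
rewrite lt_min => /andP[tr1 tr2].
have := H1 t; rewrite t0 tr1 => /(_ isT) {}H1.
have := H2 t; rewrite t0 tr2 [x + _ + _]addrAC => /(_ isT) {}H2.
have t20 : 0 < t ^+ 2 by rewrite exprn_gt0.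
have aux (A B C D p q s : R) : `|A - B - C + D - p| <= s ->
    `|A - C - B + D - q| <= s -> `|q - p| <= s + s.
  have -> : q - p = (A - B - C + D - p) - (A - C - B + D - q) by ring.
  by move=> H3 H4; rewrite (le_trans (ler_normB _ _))// lerD.
have := aux _ _ _ _ _ _ _ H1 H2.
rewrite -mulrBr normrM (gtr0_norm t20) -mulrDl -splitr mulrC.
by rewrite ler_pM2r.
Qed.

End differentials.

(** * Gaussian exponential moments *)

Section gaussian_moments.
Context {R : realType}.
Local Notation mR := (measurableTypeR R).
Local Notation mu := (@lebesgue_measure R).
Local Notation N01 := (normal_prob (0 : R) 1).

(** The Radon-Nikodym derivative of the normal law and its explicit density have the same integral
    over every measurable set, hence agree almost everywhere. *)
Lemma ge0_integral_normal (f : mR -> \bar R) : measurable_fun setT f ->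
  (forall x, (0 <= f x)%E) ->
  (\int[N01]_x f x = \int[mu]_x (f x * (normal_pdf 0 1 x)%:E))%E.
Proof.
move=> mf f0; have dom := normal_prob_dominates (0 : R) 1.
rewrite -(Radon_Nikodym_SigmaFinite.change_of_variables dom)//.
have iRN := Radon_Nikodym_SigmaFinite.f_integrable dom.
have mRN := measurable_int _ iRN.
have mpdf : measurable_fun [set: mR] (fun x : mR => (normal_pdf (0 : R) 1 x)%:E).
  by apply/measurable_EFinP; exact: measurable_normal_pdf.
apply: ge0_ae_eq_integral => //.
- exact: emeasurable_funM.
- exact: emeasurable_funM.
- by move=> x _; rewrite mule_ge0// Radon_Nikodym_SigmaFinite.f_ge0.
- by move=> x _; rewrite mule_ge0// lee_fin normal_pdf_ge0.
- apply: ae_eqe_mul2l => /=; apply: integral_ae_eq => // A _ mA.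
  by rewrite -Radon_Nikodym_SigmaFinite.f_integral.
Qed.

(** The product of [exp (l x^2)] and the standard density is [s] times the centred normal density of
    standard deviation [s = (1 - 2 l)^(-1/2)]. *)
Lemma integral_normal_exp_sqr (l : R) : l < 2^-1 ->
  (\int[N01]_x (expR (l * x ^+ 2))%:E = ((Num.sqrt (1 - 2 * l))^-1)%:E)%E.
Proof.
move=> l2; have a0 : 0 < 1 - 2 * l by lra.
rewrite ge0_integral_normal; last first.
- by move=> x; rewrite lee_fin expR_ge0.
- apply/measurable_EFinP; apply: measurableT_comp => //.
  by apply: measurable_funM => //; exact: measurable_funX.
set s := (Num.sqrt (1 - 2 * l))^-1.
have s0 : 0 < s by rewrite invr_gt0 sqrtr_gt0.
have s2 : s ^+ 2 = (1 - 2 * l)^-1 by rewrite exprVn sqr_sqrtr// ltW.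
transitivity (\int[mu]_x (s%:E * (normal_pdf 0 s x)%:E))%E.
  apply: eq_integral => x _; rewrite -!EFinM; congr EFin.
  rewrite !normal_pdfE ?gt_eqF// /normal_fun /normal_peak.
  rewrite mulrCA [RHS]mulrA -expRD; congr (_ * expR _); last first.
    by rewrite !subr0 s2 expr1n; field; rewrite gt_eqF.
  rewrite expr1n mul1r -mulrnAr sqrtrM ?sqr_ge0// sqrtr_sqr gtr0_norm//.
  by rewrite invfM mulrA mulfV ?mul1r// gt_eqF.
rewrite ge0_integralZl//.
- by rewrite integral_normal_pdf mule1.
- by apply/measurable_EFinP; exact: measurable_normal_pdf.
- by move=> x _; rewrite lee_fin normal_pdf_ge0.
- by rewrite lee_fin ltW.
Qed.

Definition sum_sqr n (t : n.-tuple mR) : R := \sum_(i < n) tnth t i ^+ 2.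

Lemma measurable_sum_sqr n : measurable_fun [set: n.-tuple mR] (@sum_sqr n).
Proof.
apply: measurable_sum => i; apply: measurable_funX.
exact: measurable_tnth.
Qed.

Lemma measurable_sum_sqr_ge n (a : R) :
  measurable [set t : n.-tuple mR | a <= sum_sqr t].
Proof.
rewrite -[X in measurable X]setTI.
have := @measurable_sum_sqr n measurableT `[a, +oo[%classic (measurable_itv _).
by congr (measurable (_ `&` _)); apply/seteqP; split => t /=; rewrite in_itv/= andbT.
Qed.

Lemma measurable_exp_sum_sqr n (l : R) :
  measurable_fun [set: n.-tuple mR] (fun t => (expR (l * sum_sqr t))%:E).
Proof.
apply/measurable_EFinP; apply: measurableT_comp => //.
by apply: measurable_funM => //; exact: measurable_sum_sqr.
Qed.

Lemma integral_gaussian_exp_sqr n (l : R) : l < 2^-1 ->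
  (\int[std_gaussian n]_t (expR (l * sum_sqr t))%:E =
    (((Num.sqrt (1 - 2 * l))^-1) ^+ n)%:E)%E.
Proof.
move=> l2; elim: n => [|n IH].
  rewrite /= integral_dirac//; last exact: measurable_exp_sum_sqr.
  by rewrite diracT mul1e /sum_sqr big_ord0 mulr0 expR0.
set c := (Num.sqrt (1 - 2 * l))^-1.
rewrite [std_gaussian _]/= ge0_integral_distribution; last first.
- by move=> t; rewrite lee_fin expR_ge0.
- exact: measurable_exp_sum_sqr.
rewrite fubini_tonelli1; last first.
- by move=> t; rewrite lee_fin expR_ge0.
- apply: measurableT_comp; first exact: measurable_exp_sum_sqr.
  exact: measurable_cons_pair.
rewrite /fubini_F /=.
have E (s : mR) (t : n.-tuple mR) : (expR (l * sum_sqr (cons_pair (s, t))))%:E =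
    ((expR (l * s ^+ 2))%:E * (expR (l * sum_sqr t))%:E)%E.
  rewrite -EFinM -expRD -mulrDr /sum_sqr big_ord_recl/=; congr (expR (_ * (_ + _)))%:E.
  by apply: eq_bigr => i _; rewrite /cons_pair/= tnthS.
transitivity (\int[N01]_s ((expR (l * s ^+ 2))%:E * (c ^+ n)%:E))%E.
  apply: eq_integral => s _; under eq_integral do rewrite E.
  rewrite ge0_integralZl//; first by rewrite IH.
  exact: measurable_exp_sum_sqr.
rewrite ge0_integralZr//.
- by rewrite integral_normal_exp_sqr// -EFinM exprS.
- apply/measurable_EFinP; apply: measurableT_comp => //.
  by apply: measurable_funM => //; exact: measurable_funX.
- by rewrite lee_fin exprn_ge0// invr_ge0 sqrtr_ge0.
Qed.

(** Markov's inequality for [exp (l |u|^2)]; the parameter [l] is optimised in [gaussian_tail]. *)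
Lemma gaussian_chernoff n (l a : R) : 0 <= l < 2^-1 ->
  ((expR (l * a))%:E * std_gaussian n [set t | (a <= sum_sqr t)%R] <=
   (((Num.sqrt (1 - 2 * l))^-1) ^+ n)%:E)%E.
Proof.
move=> /andP[l0 l2]; rewrite -integral_gaussian_exp_sqr//.
have mA := @measurable_sum_sqr_ge n a.
rewrite -integral_cst//.
apply: (@le_trans _ _ (\int[std_gaussian n]_(t in [set t | (a <= sum_sqr t)%R])
    (expR (l * sum_sqr t))%:E)%E).
  apply: ge0_le_integral => //.
  - by move=> t _; rewrite lee_fin expR_ge0.
  - by apply/measurable_funTS; exact: measurable_exp_sum_sqr.
  - by move=> t /= ta; rewrite lee_fin ler_expR ler_wpM2l.
apply: ge0_subset_integral => //; exact: measurable_exp_sum_sqr.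
Qed.

Lemma integrable_sum_sqr n :
  (std_gaussian n).-integrable setT (fun t => (sum_sqr t)%:E).
Proof.
(* The dominating function comes from [r <= 4 exp (r / 4)], whose exponent [1/4] is below the
   threshold [1/2] for a finite Gaussian integral. *)
have l2 : (4^-1 : R) < 2^-1 by rewrite ltf_pV2 ?posrE// ltr_nat.
apply: (@le_integrable _ _ _ _ _ measurableT _
    (fun t => 4%:E * (expR (4^-1 * sum_sqr t))%:E)%E).
- by apply/measurable_EFinP; exact: measurable_sum_sqr.
- move=> t _; rewrite -EFinM !abse_EFin lee_fin.
  have s0 : 0 <= sum_sqr t by apply: sumr_ge0 => i _; exact: sqr_ge0.
  rewrite ger0_norm// ger0_norm ?mulr_ge0 ?expR_ge0// -ler_pdivrMl//.
  by rewrite (le_trans _ (expR_ge1Dx _))// lerDr.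
- apply: integrableZl => //; apply/integrableP; split; first exact: measurable_exp_sum_sqr.
  under eq_integral do rewrite gee0_abs ?lee_fin ?expR_ge0//.
  by rewrite integral_gaussian_exp_sqr// ltry.
Qed.

End gaussian_moments.

(** * Gradients of Gaussian means *)

Section gradient_calculus.
Context {R : realType} {d : nat}.
Implicit Types (g : 'cV[R]_d -> R) (x p u v : 'cV[R]_d).

Lemma has_gradient_affine g x p (s : R) u : has_gradient g (x + s *: u) p ->
  has_gradient (fun u => g (x + s *: u)) u (s *: p).
Proof.
move=> gp e e0; have s0 : 0 < `|s| + 1 by rewrite ltr_pwDr.
have es0 : 0 < e / (`|s| + 1) by rewrite divr_gt0.
have [r r0 Hr] := gp _ es0.
exists (r / (`|s| + 1)); first by rewrite divr_gt0.
move=> v; rewrite ltr_pdivlMr// => vr.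
have sv : `|s *: v| <= `|v| * (`|s| + 1).
  by rewrite normrZ mulrC ler_wpM2l// lerDl.
have := Hr _ (le_lt_trans sv vr).
rewrite dotZr dotZl scalerDr addrA => H; rewrite (le_trans H)//.
by rewrite -mulrA ler_pM2l// ler_pdivrMl// mulrC.
Qed.

Lemma has_gradient_affineV g x (s : R) u : s != 0 ->
  (exists q, has_gradient (fun u => g (x + s *: u)) u q) ->
  exists p, has_gradient g (x + s *: u) p.
Proof.
move=> s0 [q Hq]; exists (s^-1 *: q).
have inv y : - (s^-1 *: x) + s^-1 *: (x + s *: y) = y.
  by rewrite scalerDr addKr scalerA mulVf// scale1r.
have inv' y : x + s *: (- (s^-1 *: x) + s^-1 *: y) = y.
  by rewrite scalerDr scalerN !scalerA mulfV// !scale1r addNKr.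
have := @has_gradient_affine (fun u => g (x + s *: u)) (- (s^-1 *: x)) q s^-1
  (x + s *: u).
rewrite inv => /(_ Hq); congr (has_gradient _ _ _).
by apply/funext => y; rewrite inv'.
Qed.

(** A Lipschitz bound along a single line controls the derivative in its direction. It serves for
    the entries of the Hessian and for the curvature along [h]. *)
Lemma has_gradient_bound g x p v (c : R) : has_gradient g x p ->
  (forall t : R, `|g (x + t *: v) - g x| <= c * `|t|) -> `|dot p v| <= c.
Proof.
move=> gp gc; apply/ler_addgt0Pr => e e0.
have v0 : 0 < `|v| + 1 by rewrite ltr_pwDr.
have ev0 : 0 < e / (`|v| + 1) by rewrite divr_gt0.
have [r r0 Hr] := gp _ ev0.
pose t := r / 2 / (`|v| + 1).
have t0 : 0 < t by rewrite !divr_gt0.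
have tv : `|t *: v| <= t * (`|v| + 1).
  by rewrite normrZ gtr0_norm// ler_wpM2l ?ltW// ltrDl.
have tvr : `|t *: v| < r.
  rewrite (le_lt_trans tv)// divfK ?gt_eqF//.
  by rewrite ltr_pdivrMr// ltr_pMr// ltr1n.
have := Hr _ tvr; have := gc t.
rewrite dotZr (gtr0_norm t0) => H1 H2.
rewrite -(ler_pM2l t0) -{1}(gtr0_norm t0) -normrM.
have -> : t * dot p v = (g (x + t *: v) - g x) - (g (x + t *: v) - g x - t * dot p v).
  by ring.
rewrite (le_trans (ler_normB _ _))// mulrDr [t * c]mulrC lerD//.
rewrite (le_trans H2)// (le_trans (ler_wpM2l (ltW ev0) tv))//.
by rewrite mulrCA divfK// gt_eqF.
Qed.

(** A partial derivative as the limit of a sequence of difference quotients, which is what the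
    measurability of the Hessian entries rests on. *)
Lemma has_gradient_diff_quotient g x p i : has_gradient g x p ->
  n.+1%:R * (g (x + n.+1%:R^-1 *: delta_mx i 0) - g x) @[n --> \oo] --> p i 0.
Proof.
move=> gp; apply/cvgrPdist_le => e e0; have [r r0 Hr] := gp e e0.
near=> n.
have n0 : 0 < n.+1%:R^-1 :> R by [].
have nr : `|n.+1%:R^-1 *: (delta_mx i 0 : 'cV[R]_d)| < r.
  rewrite normrZ norm_delta mulr1 gtr0_norm//.
  by near: n; exact: near_infty_natSinv_lt (PosNum r0).
rewrite distrC; have := Hr _ nr; rewrite normrZ norm_delta mulr1 (gtr0_norm n0) dotZr dot_delta.
rewrite -(ler_pM2l (_ : 0 < n.+1%:R)) ?ltr0Sn// mulrCA mulfV ?mulr1 ?pnatr_eq0//.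
rewrite -[X in X * `|_|]ger0_norm// -normrM; apply: le_trans.
rewrite le_eqVlt; apply/orP; left; apply/eqP; congr `|_|.
by rewrite [RHS]mulrBr [n.+1%:R * (_^-1 * _)]mulrA mulfV ?mul1r ?pnatr_eq0.
Unshelve. all: by end_near. Qed.

End gradient_calculus.

(** * Differentiation under the Gaussian expectation *)

Section gaussian_mean.
Context {R : realType} {d : nat}.
Local Notation mR := (measurableTypeR R).
Local Notation gam := (@std_gaussian R d).
Local Notation vec := (@vec_of_tuple R d).
Implicit Types (g : 'cV[R]_d -> R) (x p u v : 'cV[R]_d).

Lemma continuous_vec_measurable g : continuous g ->
  measurable_fun [set: d.-tuple mR] (g \o vec).
Proof.
move=> cg; apply: (measurability _ (RGenOInfty.measurableE R)) => // _ [_ [a ->] <-].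
rewrite setTI.
apply: (@tuple_open_measurable R d (g @^-1` `]a, +oo[%classic)).
by apply: open_comp => [y _|]; [exact: cg|rewrite set_itvoy; exact: open_gt].
Qed.

Lemma vec_norm_le (t : d.-tuple mR) : `|vec t| ^+ 2 <= sum_sqr t.
Proof.
have s0 : 0 <= sum_sqr t by apply: sumr_ge0 => i _; exact: sqr_ge0.
rewrite -(sqr_sqrtr s0) lerXn2r ?nnegrE ?sqrtr_ge0//.
apply: cV_norm_le; first exact: sqrtr_ge0.
move=> i; rewrite mxE -sqrtr_sqr ler_wsqrtr// /sum_sqr (bigD1 i)//= lerDl.
by apply: sumr_ge0 => j _; exact: sqr_ge0.
Qed.

(** The Gaussian has finite second moments, and [|u|^2] in the sup norm is at most the sum of
    squares. *)
Lemma integrable_growth g (a b : R) : continuous g ->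
  (forall u, `|g u| <= a + b * `|u| ^+ 2) ->
  gam.-integrable setT (EFin \o (g \o vec)).
Proof.
move=> cg gab.
apply: (@le_integrable _ _ _ _ _ measurableT _
    (fun t => (`|a|)%:E + `|b|%:E * (sum_sqr t)%:E)%E).
- by apply/measurable_EFinP; exact: continuous_vec_measurable.
- move=> t _; rewrite -EFinM -EFinD !abse_EFin lee_fin.
  have s0 : 0 <= sum_sqr t by apply: sumr_ge0 => i _; exact: sqr_ge0.
  rewrite [leRHS]ger0_norm ?addr_ge0 ?mulr_ge0//.
  rewrite (le_trans (gab _))// lerD ?ler_norm//.
  rewrite (le_trans (ler_wpM2r _ (ler_norm b)))// ?exprn_ge0//.
  by rewrite ler_wpM2l// vec_norm_le.
- apply: integrableD => //; first exact: finite_measure_integrable_cst.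
  by apply: integrableZl => //; exact: integrable_sum_sqr.
Qed.

Lemma integrable_bounded (h : d.-tuple mR -> R) (M : R) :
  measurable_fun setT h -> (forall t, `|h t| <= M) ->
  gam.-integrable setT (EFin \o h).
Proof.
move=> mh hM; apply: (@le_integrable _ _ _ _ _ measurableT _ (cst M%:E)).
- exact/measurable_EFinP.
- move=> t _; rewrite /= lee_fin [leRHS]ger0_norm//.
  by rewrite (le_trans _ (hM t)).
- exact: finite_measure_integrable_cst.
Qed.

Lemma Rintegral_cvg0 (h : nat -> d.-tuple mR -> R) (M : R) :
  (forall n, measurable_fun setT (h n)) -> (forall n t, `|h n t| <= M) ->
  {ae gam, forall t, h n t @[n --> \oo] --> 0} ->
  \int[gam]_t h n t @[n --> \oo] --> 0.
Proof.
move=> mh hM h0.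
have [] := @dominated_convergence _ _ _ gam setT measurableT
  (fun n t => (h n t)%:E) (cst 0%E) (cst M%:E).
- by move=> n; exact/measurable_EFinP.
- exact: measurable_cst.
- by move: h0; apply: filterS => t ht _; apply: cvg_EFin; [exact: nearW|exact: ht].
- exact: finite_measure_integrable_cst.
- by apply: aeW => t n _; rewrite lee_fin.
by move=> _ _; rewrite integral0 => /fine_cvg.
Qed.

Lemma Rintegral_lin (h1 h2 : d.-tuple mR -> R) (q : d.-tuple mR -> 'cV[R]_d) v :
  gam.-integrable setT (EFin \o h1) -> gam.-integrable setT (EFin \o h2) ->
  (forall j, gam.-integrable setT (EFin \o (fun t => q t j 0))) ->
  gam.-integrable setT (EFin \o (fun t => h1 t - h2 t - dot (q t) v)) /\
  \int[gam]_t (h1 t - h2 t - dot (q t) v) =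
  \int[gam]_t h1 t - \int[gam]_t h2 t - dot (\col_j \int[gam]_t q t j 0) v.
Proof.
move=> i1 i2 iq.
have iqv j : gam.-integrable setT (EFin \o (fun t => v j 0 * q t j 0)).
  exact: (integrableZl measurableT (v j 0) (iq j)).
have idot : gam.-integrable setT (EFin \o (fun t => dot (q t) v)).
  rewrite (_ : _ \o _ = fun t => (\sum_j (v j 0 * q t j 0)%:E)%E).
    by apply: (integrable_sum measurableT) => j _; exact: iqv.
  apply/funext => t /=; rewrite sumEFin dotE; congr EFin.
  by apply: eq_bigr => j _; rewrite mulrC.
have i12 : gam.-integrable setT (EFin \o (fun t => h1 t - h2 t)).
  exact: (integrableB measurableT i1 i2).
split; first exact: (integrableB measurableT i12 idot).
rewrite RintegralB// RintegralB//; congr (_ - _).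
rewrite dotE /Rintegral.
rewrite (_ : (\int[gam]_t (dot (q t) v)%:E =
    \sum_j \int[gam]_t (v j 0 * q t j 0)%:E)%E).
  rewrite -sum_fine; last by move=> j _; exact: (integrable_fin_num measurableT (iqv j)).
  apply: eq_bigr => j _; rewrite mxE mulrC.
  exact: (@RintegralZl _ _ _ gam setT (fun t => q t j 0)).
rewrite -integral_sum//.
apply: eq_integral => t _; rewrite sumEFin dotE; congr EFin.
by apply: eq_bigr => j _; rewrite mulrC.
Qed.

(* Differentiation under the expectation, for a merely Lipschitz integrand: a
   pointwise gradient for almost every [u] is enough, by dominated convergence
   applied to the remainders of the first-order expansions. *)
Lemma gauss_mean_has_gradient g (K C s : R) x (P : 'cV[R]_d -> 'cV[R]_d) :
  (forall y z, `|g y - g z| <= K * `|y - z|) ->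
  (forall u, `|P u| <= C) ->
  (forall j, measurable_fun setT (fun t : d.-tuple mR => P (vec t) j 0)) ->
  {ae gam, forall t, has_gradient g (x + s *: vec t) (P (vec t))} ->
  has_gradient (fun y => gauss_mean (fun u => g (y + s *: u))) x
    (\col_j gauss_mean (fun u => P u j 0)).
Proof.
move=> gK PC mP gP.
have addDBl (a b : 'cV[R]_d) : a + b - a = b by rewrite addrC addKr.
have cg y : continuous (fun u => g (y + s *: u)).
  apply: (@lipschitz_continuous _ _ _ (`|K| * `|s|)) => u u'.
  rewrite (le_trans (gK _ _))// opprD addrACA subrr add0r -scalerBr normrZ mulrA.
  by rewrite ler_wpM2r// ler_wpM2r// ler_norm.
have ig y : gam.-integrable setT (EFin \o (fun t => g (y + s *: vec t))).
  apply: (@integrable_growth (fun u => g (y + s *: u)) (`|g y| + `|K| * `|s|)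
    (`|K| * `|s|)) => // u.
  rewrite -[g _](subrK (g y)) (le_trans (ler_normD _ _))// addrC -addrA lerD//.
  rewrite (le_trans (gK _ _))// addDBl normrZ.
  rewrite (le_trans (ler_wpM2r _ (ler_norm K)))// mulrA -[X in X + _]mulr1 -mulrDr.
  rewrite ler_wpM2l ?mulr_ge0//.
  have [u1|/ltW u1] := leP `|u| 1; first by rewrite (le_trans u1)// lerDl exprn_ge0.
  by rewrite (le_trans (ler_eXnr _ u1 : _ <= `|u| ^+ 2))// lerDr.
have iP j : gam.-integrable setT (EFin \o (fun t => P (vec t) j 0)).
  apply: (@integrable_bounded _ C) => // t.
  by rewrite (le_trans _ (PC (vec t)))// mx_norm_coord.
move=> e e0; apply/not_exists2P => H.
(* If no radius works for [e], there are increments [v n] of norm below [1/(n+1)] that violate the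
   estimate. The remainders divided by [|v n|] are bounded and tend to [0] almost everywhere, so
   their means tend to [0], a contradiction. *)
have {}H n : exists v, `|v| < n.+1%:R^-1 /\
    ~ (`|gauss_mean (fun u => g (x + v + s *: u)) -
      gauss_mean (fun u => g (x + s *: u)) -
      dot (\col_j gauss_mean (fun u => P u j 0)) v| <= e * `|v|).
  have [//|] := H n.+1%:R^-1.
  by move=> /existsNP[v /not_implyP[]]; exists v.
pose v n := sval (cid (H n)).
have vn n : `|v n| < n.+1%:R^-1 by rewrite /v; case: cid => ? [].
have vF n : ~ (`|gauss_mean (fun u => g (x + v n + s *: u)) -
      gauss_mean (fun u => g (x + s *: u)) -
      dot (\col_j gauss_mean (fun u => P u j 0)) (v n)| <= e * `|v n|).
  by rewrite /v; case: cid => ? [].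
pose h n t := `|v n|^-1 *
  (g (x + v n + s *: vec t) - g (x + s *: vec t) - dot (P (vec t)) (v n)).
have v0 n : 0 < `|v n|.
  rewrite normr_gt0; apply/eqP => vn0; apply: (vF n).
  by rewrite vn0 addr0 subrr sub0r normrN -(scale0r 0) dotZr mul0r normr0 scale0r normr0 mulr0.
have mh n : measurable_fun setT (h n).
  apply: measurable_funM => //; apply: measurable_funB.
    apply: measurable_funB; exact: (continuous_vec_measurable (cg _)).
  rewrite (_ : (fun t => _) = (fun t => \sum_j P (vec t) j 0 * v n j 0)).
    by apply: measurable_sum => j; exact: measurable_funM.
  by apply/funext => t; rewrite dotE.
have hM n t : `|h n t| <= `|K| + d%:R * C.
  rewrite /h normrM normrV ?unitfE ?normr_eq0 -?normr_gt0// normr_id.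
  rewrite ler_pdivrMl// (le_trans (ler_normB _ _))// mulrDr lerD//.
    rewrite (le_trans (gK _ _))// opprD addrACA subrr addr0 addDBl mulrC.
    by rewrite ler_wpM2l// ler_norm.
  rewrite (le_trans (dot_le_norm _ _))// mulrC ler_wpM2l//.
  by rewrite ler_wpM2l.
have h0 : {ae gam, forall t, h n t @[n --> \oo] --> 0}.
  move: gP; apply: filterS => t gt; apply/cvgrPdist_le => e1 e10.
  have [r r0 Hr] := gt e1 e10.
  near=> n; rewrite sub0r normrN.
  rewrite /h normrM normrV ?unitfE ?normr_eq0 -?normr_gt0// normr_id.
  rewrite ler_pdivrMl// [leRHS]mulrC [x + v n + _]addrAC; apply: Hr.
  rewrite (lt_trans (vn n))//.
  by near: n; exact: near_infty_natSinv_lt (PosNum r0).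
have /cvgrPdist_lt /(_ e e0) [N _ /(_ N (leqnn N))] := Rintegral_cvg0 mh hM h0.
rewrite sub0r normrN /h RintegralZl//; last exact: (Rintegral_lin _ (ig _) (ig _) iP).1.
rewrite (Rintegral_lin _ (ig _) (ig _) iP).2.
rewrite normrM normrV ?unitfE ?normr_eq0 -?normr_gt0// normr_id.
by rewrite ltr_pdivrMl// mulrC => /ltW; exact: vF.
Unshelve. all: by end_near. Qed.

End gaussian_mean.

(** * The Hessian of the Gaussian smoothing *)

Lemma cV_subE (R : realType) d (u v : 'cV[R]_d) i : (u - v) i 0 = u i 0 - v i 0.
Proof. by rewrite !mxE. Qed.

Lemma affine_continuous (R : realType) (V W : normedModType R) (g : V -> W)
  (s : R) (x : V) : continuous g -> continuous (fun u => g (x + s *: u)).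
Proof.
move=> cg u; apply: (@cvg_comp _ _ _ (fun u => x + s *: u) g); last exact: cg.
by apply: cvgD; [exact: cvg_cst|exact: scaler_continuous].
Qed.

Section smoothing.
Context {R : realType} {d : nat}.
Local Notation mR := (measurableTypeR R).
Local Notation gam := (@std_gaussian R d).
Local Notation vec := (@vec_of_tuple R d).
(** In the application [G] is [gradient f], and [H] further down is [hessian f]; [K] is a Lipschitz
    constant for the sup norm. *)
Variables (f : 'cV[R]_d -> R) (G : 'cV[R]_d -> 'cV[R]_d) (K : R).
Hypothesis fG : forall x, has_gradient f x (G x).
Hypothesis gK : forall x y, `|G x - G y| <= K * `|x - y|.
Implicit Types x u v : 'cV[R]_d.

Let gradient_coord_lipschitz i x y :
  `|G x i 0 - G y i 0| <= K * `|x - y|.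
Proof.
by rewrite (le_trans _ (gK x y))// -cV_subE mx_norm_coord.
Qed.

Lemma first_order_error x v :
  `|f (x + v) - f x - dot (G x) v| <= d%:R * `|K| * `|v| ^+ 2.
Proof.
have df y : differentiable f y := (has_gradient_diff (fG y)).1.
have [c /andP[c0 c1] ->] := mean_value_line x v df.
rewrite (has_gradient_gradient (fG _)).
rewrite -dotBl (le_trans (dot_le_norm _ _))// -!mulrA ler_wpM2l// expr2 mulrA.
rewrite ler_wpM2r// (le_trans (gK _ _))//.
rewrite (le_trans (ler_wpM2r _ (ler_norm K)))// ler_wpM2l//.
have -> : x + c *: v - x = c *: v by rewrite addrC addKr.
by rewrite normrZ ger0_norm// ler_piMl.
Qed.

Lemma integrable_smooth (s : R) x :
  gam.-integrable setT (EFin \o (fun t => f (x + s *: vec t))).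
Proof.
have cf : continuous f.
  by move=> y; apply/differentiable_continuous; exact: (has_gradient_diff (fG y)).1.
apply: (@integrable_growth _ _ (fun u => f (x + s *: u))
  (`|f x| + d%:R * `|G x| * `|s|)
  (d%:R * `|G x| * `|s| + d%:R * `|K| * `|s| ^+ 2)).
  exact: affine_continuous.
move=> u; have HE := first_order_error x (s *: u).
have -> : f (x + s *: u) = f x + dot (G x) (s *: u) +
    (f (x + s *: u) - f x - dot (G x) (s *: u)) by ring.
rewrite (le_trans (ler_normD _ _))// (le_trans (lerD (ler_normD _ _) HE))//.
rewrite mulrDl addrA; apply: lerD; last first.
  by rewrite normrZ exprMn !mulrA.
rewrite -addrA lerD2l.
rewrite (le_trans (dot_le_norm _ _))// normrZ mulrA -[X in X + _]mulr1 -mulrDr.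
rewrite ler_wpM2l ?mulr_ge0//.
have [u1|/ltW u1] := leP `|u| 1; first by rewrite (le_trans u1)// lerDl exprn_ge0.
by rewrite (le_trans (ler_eXnr _ u1 : _ <= `|u| ^+ 2))// lerDr.
Qed.

Lemma integrable_grad_smooth (s : R) x j :
  gam.-integrable setT (EFin \o (fun t => G (x + s *: vec t) j 0)).
Proof.
have cg : continuous (fun y => G y j 0).
  by apply: (@lipschitz_continuous _ _ _ K) => y z; exact: gradient_coord_lipschitz.
apply: (@integrable_growth _ _ (fun u => G (x + s *: u) j 0)
  (`|G x j 0| + `|K| * `|s|) (`|K| * `|s|)).
  exact: (affine_continuous cg).
move=> u; rewrite -(subrK (G x j 0) (G (x + s *: u) j 0)).
rewrite (le_trans (ler_normD _ _))// addrC -addrA lerD2l.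
rewrite (le_trans (gradient_coord_lipschitz _ _ _))//.
have -> : x + s *: u - x = s *: u by rewrite addrC addKr.
rewrite normrZ (le_trans (ler_wpM2r _ (ler_norm K)))// mulrA.
rewrite -[X in X + _]mulr1 -mulrDr ler_wpM2l ?mulr_ge0//.
have [u1|/ltW u1] := leP `|u| 1; first by rewrite (le_trans u1)// lerDl exprn_ge0.
by rewrite (le_trans (ler_eXnr _ u1 : _ <= `|u| ^+ 2))// lerDr.
Qed.

(** The first-order remainder of [f] is quadratic in [v], uniformly in the base point, so it can
    simply be integrated. *)
Lemma smooth_has_gradient (s : R) x : has_gradient (gauss_smooth s f) x
  (\col_j gauss_mean (fun u => G (x + s *: u) j 0)).
Proof.
move=> e e0.
have c0 : 0 < d%:R * `|K| + 1 by rewrite ltr_pwDr ?mulr_ge0.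
exists (e / (d%:R * `|K| + 1)); first by rewrite divr_gt0.
move=> v; rewrite ltr_pdivlMr// => vr.
have [i1 E1] := Rintegral_lin v (integrable_smooth s (x + v)) (integrable_smooth s x)
  (integrable_grad_smooth s x).
rewrite -[X in `|X|]E1 (le_trans (le_normr_Rintegral _ i1))//.
have inorm := integrable_abse i1.
apply: (@le_trans _ _ (\int[gam]_t (d%:R * `|K| * `|v| ^+ 2))).
  apply: le_Rintegral => //; first exact: finite_measure_integrable_cst.
  by move=> t _; rewrite [x + v + _]addrAC; exact: first_order_error.
rewrite Rintegral_cst// (_ : fine _ = 1); last by rewrite /= (probability_setT gam).
rewrite mulr1 expr2 mulrA ler_wpM2r//.
by rewrite (le_trans _ (ltW vr))// mulrC ler_wpM2l// lerDl.
Qed.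

Lemma gradient_smooth (s : R) x i :
  gradient (gauss_smooth s f) x i 0 = gauss_mean (fun u => G (x + s *: u) i 0).
Proof. by rewrite (has_gradient_gradient (smooth_has_gradient s x)) mxE. Qed.


(** [H] is constrained only where [G] is differentiable; elsewhere the indicator of [D] hides its
    value. *)
Variable H : 'cV[R]_d -> 'M[R]_d.
Hypothesis GH : forall x, differentiable G x -> forall i,
  has_gradient (fun y => G y i 0) x (\col_j H x i j).

Lemma hessian_bound x i : differentiable G x -> `|\col_j H x i j| <= `|K|.
Proof.
move=> ddf; apply: cV_norm_le => // j.
rewrite -dot_delta; apply: (has_gradient_bound (GH ddf i)) => t.
rewrite (le_trans (gradient_coord_lipschitz _ _ _))//.
have -> : x + t *: delta_mx j 0 - x = t *: delta_mx j 0 :> 'cV[R]_d.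
  by rewrite addrC addKr.
by rewrite normrZ norm_delta mulr1 ler_wpM2r// ler_norm.
Qed.

Variables (s : R) (x : 'cV[R]_d).
Hypothesis s0 : 0 < s.
Local Notation D := [set u : 'cV[R]_d | differentiable G (x + s *: u)].

(** Restates membership in [D] coordinate by coordinate and in the Gaussian variable, the form in
    which [linear_approx_measurable] and [rademacher] apply. *)
Lemma diff_domainP t : D (vec t) <-> forall i, exists p,
  has_gradient (fun u => G (x + s *: u) i 0) (vec t) p.
Proof.
split=> [dt i|Hi].
  exists (s *: \col_j H (x + s *: vec t) i j).
  exact: (@has_gradient_affine _ _ (fun y => G y i 0) _ _ _ _ (GH dt i)).
have {}Hi i : exists p, has_gradient (fun y => G y i 0) (x + s *: vec t) p.
  by apply: (@has_gradient_affineV _ _ (fun y => G y i 0)) => //; rewrite gt_eqF.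
apply: (@differentiable_of_coord _ _ _ _
  (\matrix_(i, j) sval (cid (Hi i)) j 0) _).1 => i.
rewrite (_ : \col_j _ = sval (cid (Hi i))); first exact: (svalP (cid (Hi i))).
by apply/colP => j; rewrite !mxE.
Qed.

Let coord_lipschitz i u v :
  `|G (x + s *: u) i 0 - G (x + s *: v) i 0| <= (`|K| * `|s|) * `|u - v|.
Proof.
rewrite (le_trans (gradient_coord_lipschitz _ _ _))//.
rewrite opprD addrACA subrr add0r -scalerBr normrZ mulrA.
by rewrite ler_wpM2r// ler_wpM2r// ler_norm.
Qed.

Lemma diff_domain_measurable : measurable (vec @^-1` D).
Proof.
rewrite (_ : _ @^-1` _ = \bigcap_(i in [set: 'I_d]) [set t | exists p,
  forall e, 0 < e -> exists2 r, 0 < r &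
    linear_approx predT (fun u => G (x + s *: u) i 0) p e r (vec t)]).
  apply: fin_bigcap_measurable; first exact: finite_finset.
  move=> i _; apply: linear_approx_measurable.
  exact: lipschitz_continuous (coord_lipschitz i).
apply/seteqP; split => t.
  move=> /diff_domainP Ht i _; have [p Hp] := Ht i.
  by exists p; exact/has_gradientP.
move=> Ht; apply/diff_domainP => i; have [p Hp] := Ht i I.
by exists p; exact/has_gradientP.
Qed.

Lemma diff_domain_ae : {ae gam, forall t, D (vec t)}.
Proof.
have : {ae gam, forall t, forall k : nat, if insub k : option 'I_d is Some i then
    exists p, has_gradient (fun u => G (x + s *: u) i 0) (vec t) p else True}.
  apply/ae_foralln => k; case: insub => [i|]; last by apply: aeW.
  exact: rademacher (coord_lipschitz i).
apply: filterS => t Ht; apply/diff_domainP => i.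
by have := Ht i; rewrite valK.
Qed.

(** On [D] the entry is a pointwise limit of difference quotients, which are continuous in the
    Gaussian variable; off [D] every term of the sequence is [0]. *)
Lemma hessian_measurable i j :
  measurable_fun setT (fun t : d.-tuple mR => (\1_D (vec t) *: H (x + s *: vec t)) i j).
Proof.
have mD : measurable_fun setT (fun t : d.-tuple mR => \1_D (vec t) : R).
  rewrite (_ : (fun t => _) = \1_(vec @^-1` D)).
    by apply: measurable_indic; exact: diff_domain_measurable.
  by apply/funext => t; rewrite !indicE; congr (nat_of_bool _)%:R.
have cg y : continuous (fun u => G (y + s *: u) i 0).
  apply: (@affine_continuous _ _ _ (fun z => G z i 0)).
  by apply: (@lipschitz_continuous _ _ _ K) => u v; exact: gradient_coord_lipschitz.
apply: (@measurable_fun_cvg _ _ _ setT (fun n (t : d.-tuple mR) =>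
    \1_D (vec t) * (n.+1%:R *
  (G (x + n.+1%:R^-1 *: delta_mx j 0 + s *: vec t) i 0 - G (x + s *: vec t) i 0)))).
  move=> n; apply: measurable_funM => //; apply: measurable_funM => //.
  apply: measurable_funB.
    exact: (continuous_vec_measurable (cg (x + n.+1%:R^-1 *: delta_mx j 0))).
  exact: (continuous_vec_measurable (cg x)).
move=> t _; rewrite mxE; rewrite indicE; have [tD|tD] := boolP (vec t \in D); last first.
  rewrite mul0r; under eq_fun do rewrite mul0r; exact: cvg_cst.
rewrite mul1r; under eq_fun do rewrite mul1r addrAC.
move: tD; rewrite inE => tD; have := has_gradient_diff_quotient (i := j) (GH tD i).
by rewrite mxE.
Qed.

Lemma hessian_entry_le u i j : `|(\1_D u *: H (x + s *: u)) i j| <= `|K|.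
Proof.
rewrite mxE indicE; have [uD|uD] := boolP (u \in D); last by rewrite mul0r normr0.
rewrite mul1r; move: uD; rewrite inE => uD.
rewrite (le_trans _ (hessian_bound i uD))//.
by rewrite (le_trans _ (mx_norm_coord _ j 0))// mxE.
Qed.

Lemma grad_smooth_has_gradient i :
  has_gradient (fun y => gauss_mean (fun u => G (y + s *: u) i 0)) x
    (\col_j gauss_mean (fun u => (\1_D u *: H (x + s *: u)) i j)).
Proof.
pose P u : 'cV[R]_d := \col_j (\1_D u *: H (x + s *: u)) i j.
have -> : \col_j gauss_mean (fun u => (\1_D u *: H (x + s *: u)) i j) =
    \col_j gauss_mean (fun u => P u j 0).
  apply/colP => j; rewrite !mxE; congr gauss_mean.
  by apply/funext => u; rewrite [RHS]mxE.
apply: (@gauss_mean_has_gradient _ _ (fun y => G y i 0) K `|K|).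
- exact: gradient_coord_lipschitz.
- by move=> u; apply: cV_norm_le => // j; rewrite [P u j 0]mxE hessian_entry_le.
- move=> j; rewrite (_ : (fun t => _) =
    (fun t : d.-tuple mR => (\1_D (vec t) *: H (x + s *: vec t)) i j)).
    exact: hessian_measurable.
  by apply/funext => t; rewrite [LHS]mxE.
- have := diff_domain_ae; apply: filterS => t tD.
  rewrite (_ : P (vec t) = \col_j H (x + s *: vec t) i j); first exact: GH.
  by apply/colP => j; rewrite !mxE indicE mem_set// mul1r.
Qed.

Lemma integrable_hessian_entry i j : gam.-integrable setT
  (EFin \o (fun t => (\1_D (vec t) *: H (x + s *: vec t)) i j)).
Proof.
apply: (@integrable_bounded _ _ _ `|K|); first exact: hessian_measurable.
by move=> t; exact: hessian_entry_le.
Qed.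

End smoothing.

Section hessian_smooth.
Context {R : realType} {d : nat}.
Variables (f : 'cV[R]_d -> R) (K : R).
Hypothesis df : forall x, differentiable f x.
Hypothesis gK : forall x y, `|gradient f x - gradient f y| <= K * `|x - y|.
Variables (s : R) (x : 'cV[R]_d).
Hypothesis s0 : 0 < s.
Local Notation D := [set u : 'cV[R]_d | differentiable (gradient f) (x + s *: u)].

Lemma hessian_smooth : hessian (gauss_smooth s f) x =
  gauss_mean_mx (fun u => \1_D u *: hessian f (x + s *: u)).
Proof.
pose A : 'M[R]_d := gauss_mean_mx (fun u => \1_D u *: hessian f (x + s *: u)).
have fG y := differentiable_has_gradient (df y).
have Hg i : has_gradient (fun y => gradient (gauss_smooth s f) y i 0) x (\col_j A i j).
  rewrite (_ : (fun y => _) =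
      (fun y => gauss_mean (fun u => gradient f (y + s *: u) i 0))).
    rewrite (_ : (\col_j A i j) =
        \col_j gauss_mean (fun u => (\1_D u *: hessian f (x + s *: u)) i j)).
      have := @grad_smooth_has_gradient R d (gradient f) K gK (hessian f)
        (@hessian_has_gradient _ _ f) s x s0 i.
      exact.
    by apply/colP => j; rewrite !mxE.
  by apply/funext => y; exact: (gradient_smooth fG gK).
have [_ dE] := differentiable_of_coord Hg.
apply/matrixP => i j; rewrite [LHS]mxE dE -/A.
by rewrite -colE mxE.
Qed.

End hessian_smooth.

(** * The Lambert radius and the Gaussian tail *)

Section lambert.
Context {R : realType}.

(** [pinv] returns a preimage inside the given set as soon as one exists; existence follows from the
    intermediate value theorem on [[-t, -1]]. *)
Lemma lambertWm1P (a : R) : - (expR 1)^-1 <= a -> a < 0 ->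
  lambertWm1 a <= -1 /\ lambertWm1 a * expR (lambertWm1 a) = a.
Proof.
move=> ae a0; pose phi (w : R) := w * expR w.
have [w w1 wa] : exists2 w, w <= -1 & phi w = a.
  (* From [exp t >= t^2 / 4] follows [t exp (-t) <= 4 / t <= -a], so the function is at least [a] at
     [-t]. *)
  pose t : R := Num.max 1 (4 / - a).
  have t1 : 1 <= t by rewrite le_max lexx.
  have t0 : 0 < t by rewrite (lt_le_trans ltr01).
  have at4 : 4 / - a <= t by rewrite le_max lexx orbT.
  have expt : t ^+ 2 / 4 <= expR t.
    rewrite [t in expR t]splitr expRD -expr2.
    have -> : t ^+ 2 / 4 = (t / 2) ^+ 2 by field.
    rewrite ler_pXn2r ?nnegrE ?divr_ge0 ?expR_ge0 ?(ltW t0)//.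
    by rewrite (le_trans _ (expR_ge1Dx _))// lerDr.
  have phit : a <= phi (- t).
    rewrite /phi expRN mulNr lerNr ler_pdivrMr ?expR_gt0//.
    rewrite (le_trans _ (ler_wpM2l _ expt))// ?oppr_ge0 ?(ltW a0)//.
    have : 4 <= t * - a by rewrite -ler_pdivrMr ?oppr_gt0.
    move=> H; rewrite mulrA ler_pdivlMr// expr2 mulrA mulrC.
    by rewrite [- a * t]mulrC ler_wpM2r// ltW.
  have cphi : continuous phi.
    by move=> x; apply: cvgM; [exact: cvg_id|exact: continuous_expR].
  have Nt1 : - t <= -1 by rewrite lerN2.
  have phi1 : phi (-1) <= a by rewrite /phi expRN mulN1r.
  have [||w] := @IVT R phi (- t) (-1) a Nt1.
  - exact: continuous_subspaceT.
  - by rewrite ge_min le_max phi1 phit orbT.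
  by rewrite in_itv/= => /andP[_ w1] wa; exists w.
have surj : set_surj (`]-oo, -1]%classic : set R) [set a] phi.
  by move=> _ ->; exists w => //=; rewrite in_itv.
split.
  have := @surjpinv_image_sub _ _ (fun=> point) _ _ _ surj (lambertWm1 a).
  by rewrite /= in_itv/=; apply; exists a.
by have := @surjpK _ _ (fun=> point) _ _ _ surj a; apply; rewrite inE.
Qed.

(** * Gaussian mass outside the ball of radius [radiusH] *)

Section tail.
Variables (d : nat) (L eps : R).
Hypotheses (d0 : (0 < d)%N) (L0 : 0 < L) (eps0 : 0 < eps).
Let eta := eta1 d L eps.
Let dR0 : 0 < d%:R :> R. Proof. by rewrite ltr0n. Qed.

Let two_pi1 : 1 <= 2 * pi :> R.
Proof. by have := @pi_ge2 R; lra. Qed.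

Lemma eta1_gt0 : 0 < eta.
Proof.
rewrite /eta /eta1 lt_min divr_gt0 ?mulr_gt0//= subr_gt0.
apply: (@lt_le_trans _ _ 1); first by rewrite invf_lt1// ltr1n.
by rewrite -[leLHS](powRr0 (2 * pi)) ler_powR// divr_ge0.
Qed.

(** The offset [1/2] in [eta1] makes this strict, and from it follow both [s < 1] and a tail bound
    below [1]. Squaring removes the fractional power. *)
Lemma eta1_sqr_lt : eta ^+ 2 < (2 * pi) ^+ d.
Proof.
have -> : (2 * pi) ^+ d = ((2 * pi) `^ (d%:R / 2)) ^+ 2 :> R.
  rewrite -[RHS]powR_mulrn ?powR_ge0// -powRrM divfK ?pnatr_eq0// powR_mulrn//.
  by rewrite (le_trans ler01).
rewrite ltr_pXn2r ?nnegrE ?powR_ge0 ?(ltW eta1_gt0)//.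
rewrite (@le_lt_trans _ _ ((2 * pi) `^ (d%:R / 2) - 2^-1))//.
  by rewrite /eta /eta1 ge_min lexx orbT.
by rewrite ltrBlDr ltrDl.
Qed.

(** The argument of the Lambert function in [radiusH] is [- s / e]. *)
Let s := eta `^ (2 / d%:R) / (2 * pi).

Let s_pow : s ^+ d = eta ^+ 2 / (2 * pi) ^+ d.
Proof.
rewrite /s expr_div_n; congr (_ / _).
rewrite -[LHS]powR_mulrn ?powR_ge0// -powRrM divfK ?gt_eqF//.
by rewrite powR_mulrn// ltW// eta1_gt0.
Qed.

Let s_gt0 : 0 < s.
Proof. by rewrite divr_gt0 ?powR_gt0 ?eta1_gt0 ?(lt_le_trans ltr01). Qed.

Let s_lt1 : s < 1.
Proof.
have pi0 : 0 < (2 * pi) ^+ d :> R by rewrite exprn_gt0// (lt_le_trans ltr01).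
have sd1 : s ^+ d < 1 by rewrite s_pow ltr_pdivrMr// mul1r eta1_sqr_lt.
rewrite ltNge; apply/negP => s1.
by move: sd1; rewrite ltNge exprn_ege1.
Qed.

(** [T] is the negated Lambert value [W]: the equation [W exp W = - s / e] becomes
    [T exp (1 - T) = s]. *)
Lemma radiusHP : exists T : R, [/\ 1 <= T, radiusH d L eps = Num.sqrt (d%:R * T) &
  T * expR (1 - T) = s].
Proof.
pose a := - (eta `^ (2 / d%:R) / (2 * pi * expR 1)).
have aE : a = - (s / expR 1) by rewrite /a /s invfM mulrA.
have a1 : - (expR 1)^-1 <= a.
  by rewrite aE lerN2 ler_pdivrMr ?expR_gt0// mulVf ?gt_eqF ?expR_gt0// ltW.
have a0 : a < 0 by rewrite aE oppr_lt0 divr_gt0 ?expR_gt0.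
have [W1 WE] := lambertWm1P a1 a0.
exists (- lambertWm1 a); split.
- by rewrite lerNr.
- by rewrite /radiusH -/eta -/a mulrN.
- rewrite opprK expRD mulrCA mulNr WE aE.
  by rewrite opprK mulrC divfK// gt_eqF// expR_gt0.
Qed.

Lemma radiusH_gt0 : 0 < radiusH d L eps.
Proof.
have [T [T1 -> _]] := radiusHP.
by rewrite sqrtr_gt0 mulr_gt0// (lt_le_trans ltr01).
Qed.

Lemma gaussian_tail : exists q : R, [/\ q < 1, q <= eps / (4 * L) &
  (std_gaussian d [set t | (radiusH d L eps ^+ 2 <= sum_sqr t)%R] <= q%:E)%E].
Proof.
have [T [T1 HE TE]] := radiusHP.
have T0 : 0 < T by rewrite (lt_le_trans ltr01).
(* The bound is [q ^+ d]; it is compared through its square, since [q ^+ 2 = s] and [s ^+ d] is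
   known. *)
pose q := Num.sqrt T * expR ((1 - T) / 2).
have q0 : 0 <= q by rewrite mulr_ge0 ?sqrtr_ge0 ?expR_ge0.
have q2 : q ^+ 2 = s.
  by rewrite exprMn sqr_sqrtr ?ltW// expr2 -expRD -splitr.
have pi0 : 1 <= (2 * pi) ^+ d :> R by rewrite exprn_ege1.
have qd2 : (q ^+ d) ^+ 2 = eta ^+ 2 / (2 * pi) ^+ d.
  by rewrite exprAC q2 s_pow.
exists (q ^+ d); split.
- rewrite -(@ltr_pXn2r _ 2) ?nnegrE ?exprn_ge0// expr1n qd2.
  by rewrite ltr_pdivrMr ?mul1r ?eta1_sqr_lt// (lt_le_trans ltr01).
- apply: (@le_trans _ _ eta); last by rewrite /eta /eta1 ge_min lexx.
  rewrite -(@ler_pXn2r _ 2) ?nnegrE ?exprn_ge0 ?(ltW eta1_gt0)// qd2.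
  by rewrite ler_pdivrMr ?(lt_le_trans ltr01)// ler_peMr ?sqr_ge0.
rewrite HE sqr_sqrtr ?mulr_ge0 ?(ltW T0)//.
(* The optimal Chernoff parameter at level [d T], given by [1 - 2 l = 1 / T]. *)
have l2 : 0 <= (1 - T^-1) / 2 < 2^-1.
  have TV1 : T^-1 <= 1 by rewrite invf_le1.
  have TV0 : 0 < T^-1 by rewrite invr_gt0.
  by apply/andP; split; lra.
have := gaussian_chernoff d (d%:R * T) l2.
have -> : 1 - 2 * ((1 - T^-1) / 2) = T^-1 by field; rewrite gt_eqF.
have -> : (1 - T^-1) / 2 * (d%:R * T) = d%:R * ((T - 1) / 2).
  by field; rewrite gt_eqF.
rewrite (sqrtrV (ltW T0)) invrK -lee_pdivlMl ?expR_gt0// -EFinM.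
congr (_ <= _%:E)%E; rewrite /q exprMn mulrC -expRN; congr (_ * _).
by rewrite -expRM_natl; congr expR; ring.
Qed.

End tail.
End lambert.

(** * The smallest eigenvalue *)

Lemma sum_fun_continuous (R : realType) (T : topologicalType) (I : Type) (r : seq I)
  (F : I -> T -> R) : (forall i, continuous (F i)) ->
  continuous (fun x => \sum_(i <- r) F i x).
Proof.
move=> cF; elim: r => [|i r IH].
  have -> : (fun x => \sum_(i <- [::]) F i x) = (fun=> 0).
    by apply/funext => x; rewrite big_nil.
  by move=> x; exact: (@cvg_cst R^o).
have -> : (fun x => \sum_(j <- i :: r) F j x) =
    (fun x => F i x + \sum_(j <- r) F j x).
  by apply/funext => x; rewrite big_cons.
by move=> x; apply: (@cvgD _ R^o); [exact: cF|exact: IH].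
Qed.

Lemma mul_fun_continuous (R : realType) (T : topologicalType) (F G : T -> R) :
  continuous F -> continuous G -> continuous (fun x => F x * G x).
Proof. by move=> cF cG x; apply: cvgM; [exact: cF|exact: cG]. Qed.

Section euclidean_norm.
Context {R : realType} {d : nat}.
Implicit Types (u v w h : 'cV[R]_d) (A : 'M[R]_d).

Lemma dot_ge0 v : 0 <= dot v v.
Proof. by rewrite dotE; apply: sumr_ge0 => i _; rewrite -expr2 sqr_ge0. Qed.

Lemma dot_eq0 v : dot v v = 0 -> v = 0.
Proof.
rewrite dotE => /psumr_eq0P H; apply/colP => i; rewrite mxE.
have /eqP := H (fun i _ => sqr_ge0 (v i 0)) i isT.
by rewrite -expr2 sqrf_eq0 => /eqP.
Qed.

Lemma enorm_sqr v : enorm v ^+ 2 = dot v v.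
Proof. by rewrite /enorm sqr_sqrtr// dot_ge0. Qed.

Lemma enorm_ge0 v : 0 <= enorm v.
Proof. exact: sqrtr_ge0. Qed.

Lemma enormZ (a : R) v : enorm (a *: v) = `|a| * enorm v.
Proof.
by rewrite /enorm dotZl dotZr mulrA -expr2 sqrtrM ?sqr_ge0// sqrtr_sqr.
Qed.

Lemma norm_le_enorm v : `|v| <= enorm v.
Proof.
apply: cV_norm_le => [|i]; first exact: enorm_ge0.
rewrite -sqrtr_sqr /enorm ler_wsqrtr// dotE (bigD1 i)//= -expr2 lerDl.
by apply: sumr_ge0 => j _; rewrite -expr2 sqr_ge0.
Qed.

Lemma enorm_le_norm v : enorm v <= d%:R * `|v|.
Proof.
have c0 : 0 <= d%:R * `|v| by rewrite mulr_ge0.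
rewrite -(@ler_pXn2r _ 2) ?nnegrE ?enorm_ge0// enorm_sqr.
rewrite (le_trans (ler_norm _))// (le_trans (dot_le_norm v v))// exprMn -mulrA -expr2.
rewrite ler_wpM2r ?sqr_ge0// -natrX ler_nat.
by case: d => // n; rewrite leq_pmull.
Qed.

Lemma cauchy_schwarz u v : `|dot u v| <= enorm u * enorm v.
Proof.
suff H w : dot u w <= enorm u * enorm w.
  rewrite ler_norml H andbT lerNl; have := H (- v).
  by rewrite -scaleN1r dotZr mulN1r enormZ normrN normr1 mul1r.
have [v0|v0] := eqVneq (enorm w) 0.
  have -> : w = 0 by apply: dot_eq0; rewrite -enorm_sqr v0 expr0n.
  by rewrite -(scale0r 0) dotZr enormZ normr0 !mul0r mulr0.
have [u0|u0] := eqVneq (enorm u) 0.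
  have -> : u = 0 by apply: dot_eq0; rewrite -enorm_sqr u0 expr0n.
  by rewrite -(scale0r 0) dotZl enormZ normr0 !mul0r.
have ab : 0 < enorm u * enorm w.
  by rewrite mulr_gt0// lt_def ?u0 ?v0 enorm_ge0.
have := dot_ge0 (enorm w *: u - enorm u *: w).
rewrite dotBl !dotBr !dotZl !dotZr (dotC w u) -!enorm_sqr => H.
rewrite -(ler_pM2l ab).
have : 0 <= 2 * (enorm u * enorm w * (enorm u * enorm w) - enorm u * enorm w * dot u w).
  by apply: (le_trans H); rewrite le_eqVlt; apply/orP; left; apply/eqP; ring.
by rewrite pmulr_rge0// subr_ge0.
Qed.

Lemma dot_mulmx_sym A u v : A^T = A -> dot u (A *m v) = dot v (A *m u).
Proof.
by move=> As; rewrite dotC /dot -[in RHS]As trmx_mul mulmxA.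
Qed.

(** The quadratic form attains its minimum on the unit sphere, and homogeneity extends the
    inequality to all [v]. The sphere consists of row vectors, the form in which
    [bounded_closed_compact] is stated. *)
Lemma rayleigh_min A : (0 < d)%N -> exists h0 : 'cV[R]_d, h0 != 0 /\
  forall v, dot h0 (A *m h0) * dot v v <= dot v (A *m v) * dot h0 h0.
Proof.
move=> d0.
pose S := [set r : 'rV[R]_d | dot r^T r^T = 1].
pose q (r : 'rV[R]_d) := dot r^T (A *m r^T).
have cdot (B : 'M[R]_d) : continuous (fun r : 'rV[R]_d => dot r^T (B *m r^T)).
  have -> : (fun r : 'rV[R]_d => dot r^T (B *m r^T)) =
      (fun r => \sum_i r 0 i * \sum_j B i j * r 0 j).
    apply/funext => r; rewrite dotE; apply: eq_bigr => i _; rewrite !mxE.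
    by congr (_ * _); apply: eq_bigr => j _; rewrite !mxE.
  apply: sum_fun_continuous => i; apply: mul_fun_continuous.
    exact: coord_continuous.
  apply: sum_fun_continuous => j; apply: mul_fun_continuous.
    exact: cst_continuous.
  exact: coord_continuous.
have S0 : S !=set0.
  exists (delta_mx 0 (Ordinal d0)); rewrite /S /= trmx_delta dot_delta.
  by rewrite mxE !eqxx.
have cS : compact S.
  apply: bounded_closed_compact.
    exists 1; split => // k k1 r; rewrite /S/= => r1.
    rewrite (le_trans _ (ltW k1))//.
    have : `|r^T| <= 1 by rewrite (le_trans (norm_le_enorm _))// /enorm r1 sqrtr1.
    move=> H; apply: mx_norm_le => // i j; rewrite ord1.
    by rewrite (le_trans _ H)// (le_trans _ (mx_norm_coord _ j 0))// mxE.
  rewrite (_ : S = (fun r : 'rV[R]_d => dot r^T (1%:M *m r^T)) @^-1` [set 1]).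
    by apply: closed_comp; [move=> ? _; exact: cdot|exact: closed_eq].
  by apply/seteqP; split => r; rewrite /S /= mul1mx.
have [r0 r0S rmin] := compact_EVT_min S0 cS (continuous_subspaceT (cdot A)).
move: r0S; rewrite inE /S /= => r01.
exists r0^T; split.
  apply/eqP => r00; move: r01; rewrite r00 -(scale0r 0) dotZl mul0r.
  by move/eqP; rewrite eq_sym oner_eq0.
move=> v; rewrite r01 mulr1.
have [->|v0] := eqVneq v 0.
  by rewrite mulmx0 -(scale0r 0) !dotZl !mul0r mulr0.
have nv : enorm v != 0.
  by apply/eqP => nv; move/eqP: v0; apply; apply: dot_eq0; rewrite -enorm_sqr nv expr0n.
pose w := (enorm v)^-1 *: v.
have ww : dot w w = 1.
  by rewrite /w dotZl dotZr -enorm_sqr mulrA -expr2 exprVn mulVf// expf_neq0.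
have := rmin w^T; rewrite inE /S /= trmxK => /(_ ww).
rewrite /w -scalemxAr dotZl dotZr mulrA -expr2 => H.
have n2 : 0 < enorm v ^+ 2 by rewrite exprn_even_gt0.
rewrite -enorm_sqr -ler_pdivlMr//; apply: (le_trans H).
by rewrite exprVn mulrC.
Qed.

(** Along [g + t B g] the form equals [2 t a + t^2 c] with [a = |B g|^2]. It could not stay
    nonnegative for small negative [t] if [a] were positive. *)
Lemma psd_kernel (B : 'cV[R]_d -> 'cV[R]_d) g :
  (forall v, 0 <= dot v (B v)) ->
  (forall (t : R) u, B (g + t *: u) = B g + t *: B u) ->
  (forall u, dot g (B u) = dot u (B g)) -> dot g (B g) = 0 -> B g = 0.
Proof.
move=> Q Blin gB Bg0; have Qw := Q (B g); have wBg := gB (B g).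
have H (t : R) : 0 <= 2 * t * dot (B g) (B g) + t ^+ 2 * dot (B g) (B (B g)).
  have := Q (g + t *: B g); rewrite Blin !dotDl !dotDr !dotZl !dotZr Bg0 wBg.
  by move=> K; apply: (le_trans K); rewrite le_eqVlt; apply/orP; left;
    apply/eqP; ring.
apply: dot_eq0; apply/eqP; rewrite eq_le dot_ge0 andbT leNgt.
apply/negP; move: Qw H; move: (dot (B g) (B g)) (dot _ _) => a c c0 H a0.
have c10 : 0 < c + 1 by rewrite ltr_pwDr.
(* The denominator [c + 1] is positive even when [c = 0]. *)
have := H (- (a / (c + 1))).
have -> : 2 * - (a / (c + 1)) * a + (- (a / (c + 1))) ^+ 2 * c =
    - (a ^+ 2 / (c + 1) ^+ 2 * (c + 2)).
  by field; rewrite gt_eqF.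
by rewrite oppr_ge0 leNgt mulr_gt0// ?divr_gt0 ?exprn_gt0// ltr_pwDr.
Qed.

(** With [m] the minimal Rayleigh quotient, [A - m] is positive semidefinite and its form vanishes
    at the minimiser, which is thus an eigenvector for [m]. Each eigenvalue is itself a Rayleigh
    quotient, so [m] is a lower bound of the spectrum. *)
Lemma lambda_min_le A h : (0 < d)%N -> A^T = A -> enorm h = 1 ->
  lambda_min A <= dot h (A *m h).
Proof.
move=> d0 As h1.
have [g [g0 gmin]] := rayleigh_min A d0.
have gg : 0 < dot g g.
  by rewrite lt_def dot_ge0 andbT; apply: contra g0 => /eqP/dot_eq0/eqP.
pose m := dot g (A *m g) / dot g g.
have mmin v : m * dot v v <= dot v (A *m v).
  by rewrite /m mulrAC ler_pdivrMr.
pose B v := A *m v - m *: v.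
have Q v : 0 <= dot v (B v) by rewrite /B dotBr dotZr subr_ge0.
have Bg0 : dot g (B g) = 0.
  by rewrite /B dotBr dotZr /m divfK ?subrr// gt_eqF.
have Bg : B g = 0.
  have Blin (t : R) u : B (g + t *: u) = B g + t *: B u.
    rewrite /B mulmxDr scalerDr opprD addrACA; congr (_ + _).
    by rewrite linearZ/= scalerBr !scalerA mulrC.
  have gB u : dot g (B u) = dot u (B g).
    by rewrite /B !dotBr !dotZr (dot_mulmx_sym _ _ As) (dotC g).
  exact: psd_kernel Q Blin gB Bg0.
have mE : eigenvalue A m.
  apply/eigenvalueP; exists g^T; last by rewrite -trmx0 (inj_eq trmx_inj).
  move/eqP: Bg; rewrite /B subr_eq0 => /eqP Ag.
  by rewrite -[in LHS]As -trmx_mul Ag linearZ.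
apply: (@le_trans _ _ m).
  apply: ge_inf => //; exists m => a /= /eigenvalueP[r ra r0].
  have rr : 0 < dot r^T r^T.
    rewrite lt_def dot_ge0 andbT; apply: contra r0 => /eqP/dot_eq0 r0.
    by rewrite -(trmxK r) r0 trmx0.
  have := mmin r^T; rewrite -[in X in _ <= X]As -trmx_mul ra linearZ dotZr.
  by rewrite ler_pM2r.
by have := mmin h; rewrite -enorm_sqr h1 expr1n mulr1.
Qed.

End euclidean_norm.

(** * Curvature along a direction *)

Section curvature.
Context {R : realType} {d : nat}.
Implicit Types (x h v : 'cV[R]_d) (A : 'M[R]_d).

(** The function [<h, G y>] changes at rate at most [L] along [h], by Cauchy-Schwarz. Working in the
    Euclidean norm keeps the constant [L] without a dimensional factor. *)
Lemma directional_curvature_le (G : 'cV[R]_d -> 'cV[R]_d) (L : R) x A h :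
  (forall y z, enorm (G y - G z) <= L * enorm (y - z)) ->
  (forall i, has_gradient (fun y => G y i 0) x (\col_j A i j)) ->
  enorm h = 1 -> `|dot h (A *m h)| <= L.
Proof.
move=> GL GA h1; have [dG dE] := differentiable_of_coord GA.
have gA : has_gradient (fun y => dot h (G y)) x (A^T *m h).
  move=> e e0; have c0 : 0 < d%:R * `|h| + 1 by rewrite ltr_pwDr ?mulr_ge0.
  have [r r0 Hr] := differentiable_approx_inv dG (divr_gt0 e0 c0).
  exists r => // v /Hr {}Hr.
  have -> : dot (A^T *m h) v = dot h (A *m v).
    by rewrite /dot trmx_mul trmxK mulmxA.
  rewrite -!dotBr; rewrite dE in Hr.
  rewrite (le_trans (dot_le_norm _ _))// (le_trans (ler_wpM2l _ Hr)) ?mulr_ge0//.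
  rewrite mulrA ler_wpM2r// mulrCA ger_pMr// ler_pdivrMr// mul1r lerDl.
  by [].
have -> : dot h (A *m h) = dot (A^T *m h) h by rewrite /dot trmx_mul trmxK mulmxA.
apply: (has_gradient_bound gA) => t; rewrite -dotBr.
rewrite (le_trans (cauchy_schwarz _ _))// h1 mul1r (le_trans (GL _ _))//.
have -> : x + t *: h - x = t *: h by rewrite addrC addKr.
by rewrite enormZ h1 mulr1.
Qed.

End curvature.

(** * Expectations of quadratic forms *)

Section expectation.
Context {R : realType} {d : nat}.
Local Notation mR := (measurableTypeR R).
Local Notation gam := (@std_gaussian R d).

Lemma Rintegral_quadratic (E : 'I_d -> 'I_d -> d.-tuple mR -> R) (h : 'cV[R]_d) :
  (forall i j, gam.-integrable setT (EFin \o E i j)) ->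
  gam.-integrable setT (EFin \o (fun t => dot h ((\matrix_(i, j) E i j t) *m h))) /\
  \int[gam]_t dot h ((\matrix_(i, j) E i j t) *m h) =
    dot h ((\matrix_(i, j) \int[gam]_t E i j t) *m h).
Proof.
move=> iE; pose F (p : 'I_d * 'I_d) t := h p.1 0 * h p.2 0 * E p.1 p.2 t.
have iF p : gam.-integrable setT (EFin \o F p).
  exact: (integrableZl measurableT _ (iE p.1 p.2)).
have quadE (M : 'M[R]_d) :
    dot h (M *m h) = \sum_(p : 'I_d * 'I_d) h p.1 0 * h p.2 0 * M p.1 p.2.
  rewrite dotE -(pair_bigA _ (fun i j => h i 0 * h j 0 * M i j))/=.
  apply: eq_bigr => i _; rewrite mxE mulr_sumr; apply: eq_bigr => j _.
  by rewrite mulrAC mulrA.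
have FE : (fun t => dot h ((\matrix_(i, j) E i j t) *m h)) = (fun t => \sum_p F p t).
  by apply/funext => t; rewrite quadE; apply: eq_bigr => p _; rewrite mxE.
have FE' : EFin \o (fun t => \sum_p F p t) = (fun t => (\sum_p (F p t)%:E)%E).
  by apply/funext => t /=; rewrite sumEFin.
rewrite FE; split.
  by rewrite FE'; apply: (integrable_sum measurableT) => p _; exact: iF.
rewrite /Rintegral; under eq_integral do rewrite -sumEFin.
rewrite (integral_sum measurableT iF) quadE.
rewrite -sum_fine; last by move=> p _; exact: (integrable_fin_num measurableT (iF p)).
apply: eq_bigr => p _; rewrite mxE.
exact: (@RintegralZl _ _ _ gam setT (E p.1 p.2) (h p.1 0 * h p.2 0)).
Qed.

(** [phi] lies below the step function [c + (L - c) 1_B]. *)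
Lemma Rintegral_le_split (phi : d.-tuple mR -> R) (B : set (d.-tuple mR)) (c L q : R) :
  measurable B -> gam.-integrable setT (EFin \o phi) -> c <= L ->
  (forall t, ~ B t -> phi t <= c) -> (forall t, phi t <= L) ->
  (gam B <= q%:E)%E -> \int[gam]_t phi t <= c + (L - c) * q.
Proof.
move=> mB iphi cL phic phiL Bq.
have iB : gam.-integrable setT (EFin \o (\1_B : d.-tuple mR -> R)).
  apply: (@integrable_bounded _ _ _ 1); first exact: measurable_indic.
  by move=> t; rewrite indicE; case: (t \in B); rewrite ?normr1 ?normr0.
have iLB : gam.-integrable setT (EFin \o (fun t => (L - c) * \1_B t : R)).
  exact: (integrableZl measurableT _ iB).
have ic : gam.-integrable setT (EFin \o (fun t : d.-tuple mR => c)).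
  exact: finite_measure_integrable_cst.
apply: (@le_trans _ _ (\int[gam]_t (c + (L - c) * \1_B t))).
  apply: le_Rintegral => //; first exact: (integrableD measurableT ic iLB).
  move=> t _; rewrite indicE; have [tB|tB] := boolP (t \in B).
    by rewrite mulr1 addrC subrK.
  by rewrite mulr0 addr0; apply: phic; move: tB; rewrite notin_setE.
rewrite RintegralD// RintegralZl// Rintegral_cst// (_ : fine _ = 1); last first.
  by rewrite /= (probability_setT gam).
rewrite mulr1 lerD2l ler_wpM2l ?subr_ge0//.
rewrite /Rintegral integral_indic// setIT -lee_fin fineK//.
by rewrite ge0_fin_numE// (le_lt_trans Bq)// ltry.
Qed.

End expectation.

Lemma cvg_cst_seq (T : topologicalType) (y : T) : (fun=> y) @ \oo --> y.
Proof. exact: cvg_cst. Qed.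

Lemma near_all (T : topologicalType) (P : T -> Prop) (y : T) :
  (forall z, P z) -> \forall z \near y, P z.
Proof. exact: nearW. Qed.

(** * Hessians as elements of the Goldstein subdifferential *)

Section goldstein.
Context {R : realType} {d : nat}.
Local Notation mR := (measurableTypeR R).
Local Notation gam := (@std_gaussian R d).
Local Notation vec := (@vec_of_tuple R d).

(** The constant sequence at [y] produces the Hessian as a limit, and both convex hulls contain
    their generators. *)
Lemma hessian_goldstein (f : 'cV[R]_d -> R) (delta : R) x y :
  (forall z, differentiable f z) -> differentiable (gradient f) y ->
  enorm (y - x) <= delta -> goldstein_hess delta f x (hessian f y).
Proof.
move=> df ddf xy B [_]; apply; exists y => // C [_]; apply.
exists (fun=> y); split; [exact: cvg_cst_seq| |exact: cvg_cst_seq].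
by move=> _; split=> //; exact: near_all.
Qed.

Lemma enorm_vec t : enorm (vec t) ^+ 2 = sum_sqr t.
Proof.
rewrite enorm_sqr dotE; apply: eq_bigr => i _.
by rewrite mxE -expr2.
Qed.

End goldstein.

(** * The curvature bound in a fixed direction *)

Section second_order.
Context {R : realType} {d : nat}.
Local Notation mR := (measurableTypeR R).
Local Notation gam := (@std_gaussian R d).
Local Notation vec := (@vec_of_tuple R d).
Variables (f : 'cV[R]_d -> R) (L : R).
Hypothesis L0 : 0 < L.
Hypothesis df : forall x, differentiable f x.
Hypothesis gL : forall x y,
  enorm (gradient f x - gradient f y) <= L * enorm (x - y).

(** The smoothing lemmas use the sup norm. The factor [d] enters only their integrability and
    measurability arguments; the constant [L] itself returns with [directional_curvature_le]. *)
Lemma gradient_sup_lipschitz x y :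
  `|gradient f x - gradient f y| <= L * d%:R * `|x - y|.
Proof.
rewrite (le_trans (norm_le_enorm _))// (le_trans (gL x y))// -mulrA.
by rewrite ler_wpM2l ?(ltW L0)// enorm_le_norm.
Qed.

Variables (s : R) (x : 'cV[R]_d).
Hypothesis s0 : 0 < s.
Local Notation D := [set u : 'cV[R]_d | differentiable (gradient f) (x + s *: u)].

Lemma hessian_smooth_sym :
  (hessian (gauss_smooth s f) x)^T = hessian (gauss_smooth s f) x.
Proof.
rewrite (hessian_smooth df gradient_sup_lipschitz x s0).
apply/matrixP => i j; rewrite !mxE; congr gauss_mean; apply/funext => u.
rewrite [LHS]mxE [RHS]mxE indicE; have [uD|uD] := boolP (u \in D); last by rewrite !mul0r.
move: uD; rewrite inE => uD; rewrite !mul1r.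
by rewrite -[in LHS](hessian_sym df uD) [LHS]mxE.
Qed.

Lemma curvature_smooth_le (h : 'cV[R]_d) (B : set (d.-tuple mR)) (c q : R) :
  enorm h = 1 -> measurable B -> (gam B <= q%:E)%E -> c <= L ->
  (forall t, ~ B t -> D (vec t) /\ dot h (hessian f (x + s *: vec t) *m h) <= c) ->
  dot h (hessian (gauss_smooth s f) x *m h) <= c + (L - c) * q.
Proof.
move=> h1 mB Bq cL Bc.
rewrite (hessian_smooth df gradient_sup_lipschitz x s0).
pose E i j (t : d.-tuple mR) := (\1_D (vec t) *: hessian f (x + s *: vec t)) i j.
have iE i j : gam.-integrable setT (EFin \o E i j).
  exact: (@integrable_hessian_entry R d (gradient f) _ gradient_sup_lipschitz
    (hessian f) (@hessian_has_gradient _ _ f) s x s0 i j).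
have [iq Eq] := Rintegral_quadratic h iE.
have -> : gauss_mean_mx (fun u => \1_D u *: hessian f (x + s *: u)) =
    \matrix_(i, j) \int[gam]_t E i j t.
  by apply/matrixP => i j; rewrite !mxE.
rewrite -Eq; have EM t : \matrix_(i, j) E i j t = \1_D (vec t) *: hessian f (x + s *: vec t).
  by apply/matrixP => i j; rewrite mxE.
apply: (Rintegral_le_split mB iq cL _ _ Bq) => t.
  move=> /Bc[tD tc]; rewrite EM indicE mem_set//.
  by rewrite scale1r.
rewrite EM indicE; have [tD|tD] := boolP (vec t \in D); last first.
  by rewrite scale0r mul0mx -(scale0r 0) dotZr mul0r ltW.
rewrite scale1r; move: tD; rewrite inE => tD.
rewrite (le_trans (ler_norm _))//.
exact: (directional_curvature_le gL (hessian_has_gradient tD) h1).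
Qed.

Lemma goldstein_curvature_ge (delta eps : R) (h : 'cV[R]_d) : (0 < d)%N ->
  0 < eps -> 0 < delta -> s <= sigma_bar d L eps delta -> enorm h = 1 ->
  ((- (2 * eps) + dot h (hessian (gauss_smooth s f) x *m h))%:E <=
   support_fun h (goldstein_hess_at delta f x h))%E.
Proof.
move=> d0 eps0 delta0 sle h1.
have H0 := radiusH_gt0 d0 L0 eps0.
have sH : s * radiusH d L eps <= delta.
  by rewrite -ler_pdivlMr// (le_trans sle)// /sigma_bar ge_min lexx orbT.
have [q [q1 qe tailq]] := gaussian_tail d0 L0 eps0.
pose T : set (d.-tuple mR) := [set t | radiusH d L eps ^+ 2 <= sum_sqr t].
have mT : measurable T by exact: measurable_sum_sqr_ge.
have mD := diff_domain_measurable gradient_sup_lipschitz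
  (@hessian_has_gradient _ _ f) x s0.
(* The bad set: the Gaussian tail and the null set where the Hessian is missing. Outside it
   [s |u| <= delta], so the Hessian belongs to the Goldstein set. *)
pose B := T `|` ~` (vec @^-1` D).
have mB : measurable B by apply: measurableU => //; exact: measurableC.
have ND0 : gam (~` (vec @^-1` D)) = 0%E.
  apply: measure_negligible; first exact: measurableC.
  exact: (diff_domain_ae gradient_sup_lipschitz (@hessian_has_gradient _ _ f) x s0).
have Bq : (gam B <= q%:E)%E.
  rewrite (le_trans (measureU2 _ _ _))//; first exact: measurableC.
  by rewrite [X in (_ + X)%E]ND0 adde0.
have good t : ~ B t -> D (vec t) /\
    goldstein_hess delta f x (hessian f (x + s *: vec t)).
  move=> /not_orP[tT /contrapT tD]; split=> //.
  apply: hessian_goldstein => //.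
  have -> : x + s *: vec t - x = s *: vec t by rewrite addrC addKr.
  rewrite enormZ gtr0_norm// (le_trans _ sH)// ler_wpM2l ?(ltW s0)// ltW//.
  rewrite -(@ltr_pXn2r _ 2) ?nnegrE ?enorm_ge0 ?(ltW H0)// enorm_vec.
  by move/negP: tT; rewrite -ltNge.
have sup_ge t : ~ B t -> ((dot h (hessian f (x + s *: vec t) *m h))%:E <=
    support_fun h (goldstein_hess_at delta f x h))%E.
  move=> /good[_ gt]; apply: ereal_sup_ubound.
  exists (hessian f (x + s *: vec t) *m h) => //.
  by exists (hessian f (x + s *: vec t)).
(* The bad set has mass at most [q < 1]. A point outside it keeps the support function away from
   [-oo] and, if finite, above [-L]. *)
have [t0 t0B] : exists t, ~ B t.
  apply: contrapT => /forallNP HB.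
  have BT : B = setT by apply/seteqP; split => // t _; exact: contrapT (HB t).
  move: Bq; rewrite BT (probability_setT gam) lee_fin leNgt.
  by rewrite q1.
have Lh t : ~ B t -> `|dot h (hessian f (x + s *: vec t) *m h)| <= L.
  move=> /good[tD _].
  exact: (directional_curvature_le gL (hessian_has_gradient tD) h1).
case E : (support_fun h (goldstein_hess_at delta f x h)) => [S| |]; last 2 first.
- by rewrite leey.
- by have := sup_ge t0 t0B; rewrite E leeNy_eq.
have S_ge t : ~ B t -> dot h (hessian f (x + s *: vec t) *m h) <= S.
  by move=> /sup_ge; rewrite E lee_fin.
rewrite lee_fin.
have q0 : 0 <= q by rewrite -lee_fin (le_trans _ Bq).
have NL_S : - L <= S.
  by rewrite (le_trans _ (S_ge _ t0B))//; have := Lh _ t0B; rewrite ler_norml => /andP[].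
have Lq : 2 * L * q <= eps.
  rewrite (le_trans (ler_wpM2l _ qe)) ?mulr_ge0 ?(ltW L0)//.
  have -> : 2 * L * (eps / (4 * L)) = eps / 2 by field; rewrite gt_eqF.
  lra.
(* If [S > L], the crude bound [c = L] is enough. Otherwise [c = S], and the excess [(L - S) q] is
   at most [2 L q <= eps] because [S >= -L]. *)
have [SL|LS] := leP S L; last first.
  have := @curvature_smooth_le h B L q h1 mB Bq (lexx L).
  rewrite subrr mul0r addr0 => H.
  have {}H := H (fun t tB => conj (good t tB).1 (le_trans (ler_norm _) (Lh t tB))).
  lra.
have H := @curvature_smooth_le h B S q h1 mB Bq SL
  (fun t tB => conj (good t tB).1 (S_ge t tB)).
have H2 : (L - S) * q <= 2 * L * q by rewrite ler_wpM2r//; lra.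
lra.
Qed.

End second_order.

Unset Implicit Arguments.

Theorem theorem3p2 (R : realType) (d : nat) (f : 'cV[R]_d -> R) (L : R)
    (hd : (0 < d)%N) (hL : 0 < L)
    (hf : forall x : 'cV[R]_d, differentiable f x)
    (hgrad : forall x y : 'cV[R]_d,
        enorm (gradient f x - gradient f y) <= L * enorm (x - y)) :
  (forall (sigma : R), 0 < sigma -> forall x h : 'cV[R]_d,
     let D := [set u : 'cV[R]_d |
                 differentiable (gradient f) (x + sigma *: u)] in
     dot h (hessian (gauss_smooth sigma f) x *m h) =
     dot h (gauss_mean_mx (fun u => \1_D u *: hessian f (x + sigma *: u))
              *m h))
  /\
  (forall eps delta : R, 0 < eps -> 0 < delta ->
     forall (x : 'cV[R]_d) (sigma : R),
       0 < sigma -> sigma <= sigma_bar d L eps delta ->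
     ((- (2 * eps) + lambda_min (hessian (gauss_smooth sigma f) x))%:E <=
      ereal_inf [set support_fun h (goldstein_hess_at delta f x h)
                | h in [set h : 'cV[R]_d | enorm h = 1%R]])%E).
Proof.
have gK := gradient_sup_lipschitz hL hgrad.
split=> [s s0 x h D|eps delta eps0 delta0 x s s0 sle].
  by rewrite (hessian_smooth hf gK x s0).
apply: le_ereal_inf_tmp => _ [h h1 <-].
apply: (le_trans _ (goldstein_curvature_ge hL hf hgrad x s0 hd eps0 delta0 sle h1)).
rewrite lee_fin lerD2l; apply: lambda_min_le => //.
exact: (hessian_smooth_sym hL hf hgrad).
Qed.
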